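(* The following three statements are equivalent: (i) (Matroid secretary conjecture) There exists an absolute constant $c>0$ and an online algorithm for the matroid secretary problem which is $c$-competitive on every matroid. (ii) There exist constants $0<\beta\le\alpha<1$ such that every matroid admits a $(\beta,\alpha)$-universal online random-order contention resolution scheme (RO-CRS). (iii) There exists a constant $0<c\le 1$ such that every matroid admits an RO-CRS which is $(c\alpha,\alpha)$-universal simultaneously for all $\alpha\in[0,1]$.
   Context: A matroid is $\mathcal{M}=(\mathcal{E},\mathcal{I})$ with finite ground set $\mathcal{E}$ and family $\mathcal{I}$ of independent sets; for weights $w\in\mathbb{R}_+^{\mathcal{E}}$, $\mathrm{rank}_w(\mathcal{M})$ denotes the maximum weight of an independent set. Matroid secretary problem: the matroid $\mathcal{M}$ is known in advance (e.g. via an independence oracle); an adversary fixes nonnegative weights $w\in\mathbb{R}_+^{\mathcal{E}}$ (without knowledge of the order); the elements then arrive online with their weights in a uniformly random order, and the algorithm must irrevocably accept or reject each element on arrival, the accepted set being independent. The algorithm is $c$-competitive on a matroid if for every $w$ the expected weight of the accepted set (over the order and internal randomness) is at least $c\cdot\mathrm{rank}_w(\mathcal{M})$. Contention resolution: a contention resolution map (CRM) for $\mathcal{M}$ is a randomized map $\phi:2^{\mathcal{E}}\to\mathcal{I}$ with $\phi(R)\subseteq R$. It is $\alpha$-balanced for a distribution $\rho$ on $2^{\mathcal{E}}$ if for $R\sim\rho$, $\Pr[i\in\phi(R)]\ge\alpha\Pr[i\in R]$ for all $i\in\mathcal{E}$. A distribution $\rho$ (arbitrarily correlated) is $\alpha$-uncontentious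 if some (offline) $\alpha$-balanced CRM exists for it. An online random-order CRM (RO-CRM) is a CRM implementable as follows: the elements of $\mathcal{E}$ are presented in a uniformly random order (independent of $R$); at each step the algorithm learns whether the current element is active (in $R$) and, if so, must irrevocably decide whether to accept it. A contention resolution scheme (CRS) for $\mathcal{M}$ and a class of distributions takes as input a (full) description of a prior $\rho$ in the class and implements a CRM $\phi_\rho$; it is an RO-CRS if every $\phi_\rho$ is an RO-CRM. For $\beta\le\alpha\le1$, a $(\beta,\alpha)$-universal CRS is one such that $\phi_\rho$ is $\beta$-balanced for $\rho$ for every $\alpha$-uncontentious distribution $\rho$ on $2^{\mathcal{E}}$. *)

(* Defs.v *)
From mathcomp Require Import all_boot all_order all_algebra all_fingroup.
From mathcomp Require Import all_classical all_reals all_analysis.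

Set Implicit Arguments.
Unset Strict Implicit.
Unset Printing Implicit Defensive.

Import Order.TTheory GRing.Theory Num.Theory.

Local Open Scope classical_set_scope.
Local Open Scope ring_scope.

Record matroid (E : finType) := Matroid {
  indep : {set {set E}};
  indep0 : finset.set0 \in indep;
  indep_hereditary : forall A B : {set E},
    A \subset B -> B \in indep -> A \in indep;
  indep_exchange : forall A B : {set E},
    A \in indep -> B \in indep -> (#|A| < #|B|)%N ->
    exists2 e : E, e \in B :\: A & e |: A \in indep }.

Definition weight (R : realType) (E : finType) (w : E -> R) (S : {set E}) : R :=
  \sum_(e in S) w e.

(* The default value 0 of the maximum is the weight of the empty set, which is
   independent, so it never changes the maximum. *)
Definition rank (R : realType) (E : finType) (M : matroid E) (w : E -> R) : R :=
  \big[Num.max/0]_(S in indep M) weight w S.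

Record fdist (R : realType) (T : finType) := Fdist {
  fdist_prob :> T -> R;
  fdist_ge0 : forall t, 0 <= fdist_prob t;
  fdist_sum1 : \sum_(t : T) fdist_prob t = 1 }.

(* A randomized online policy for elements of [E] that each reveal a datum in
   [X] on arrival: a random seed is drawn once, and [accept u h] is the
   (irrevocable) decision on the last element of [h], the sequence of arrivals
   up to and including the current one. Past decisions are functions of the
   seed and of the earlier arrivals, hence need not be recorded in [h]. *)
Record policy (R : realType) (E : finType) (X : Type) := Policy {
  seed_display : measure_display;
  seed : measurableType seed_display;
  seed_law : probability seed R;
  accept : seed -> seq (E * X) -> bool;
  measurable_accept : forall h, measurable [set u | accept u h] }.

Definition arrival_order (E : finType) (s : {perm E}) : seq E :=
  [seq s e | e <- enum E].

Definition accepted (R : realType) (E : finType) (X : Type)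
    (A : policy R E X) (x : E -> X) (s : {perm E}) (u : seed A) : {set E} :=
  [set e : E | let o := arrival_order s in
               accept u [seq (a, x a) | a <- take (index e o).+1 o]]%SET.

(* Probability, over the seed and an independent uniformly random order, that
   exactly the set [S] is accepted. *)
Definition output_law (R : realType) (E : finType) (X : Type)
    (A : policy R E X) (x : E -> X) (S : {set E}) : R :=
  (\sum_(s : {perm E}) fine (seed_law A [set u | accepted x s u = S]))
    / #|{perm E}|%:R.

Record secretary_algorithm (R : realType) (E : finType) (M : matroid E) :=
  SecretaryAlgorithm {
    secretary_policy :> policy R E R;
    secretary_indep : forall (w : E -> R) (s : {perm E})
      (u : seed secretary_policy),
      (forall e, 0 <= w e) -> accepted w s u \in indep M }.

Definition competitive (R : realType) (E : finType) (M : matroid E) (c : R)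
    (A : secretary_algorithm R M) : Prop :=
  forall w : E -> R, (forall e, 0 <= w e) ->
    c * rank M w <= \sum_(S : {set E}) output_law A w S * weight w S.

Record crm (R : realType) (E : finType) (M : matroid E) := Crm {
  crm_law :> {set E} -> fdist R {set E};
  crm_support : forall Q S : {set E},
    crm_law Q S != 0 -> (S \subset Q) && (S \in indep M) }.

Definition balanced (R : realType) (E : finType) (M : matroid E) (alpha : R)
    (phi : crm R M) (rho : fdist R {set E}) : Prop :=
  forall i : E,
    alpha * (\sum_(Q : {set E} | i \in Q) rho Q) <=
    \sum_(Q : {set E}) rho Q * \sum_(S : {set E} | i \in S) phi Q S.

Definition uncontentious (R : realType) (E : finType) (M : matroid E)
    (alpha : R) (rho : fdist R {set E}) : Prop :=
  exists phi : crm R M, balanced alpha phi rho.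

(* Each arriving element reveals whether it is active. *)
Definition ro_crm (R : realType) (E : finType) (M : matroid E)
    (phi : crm R M) : Prop :=
  exists A : policy R E bool,
    (forall (Q : {set E}) (s : {perm E}) (u : seed A),
       let S := accepted (fun e => e \in Q) s u in
       (S \subset Q) && (S \in indep M)) /\
    (forall Q S : {set E}, phi Q S = output_law A (fun e => e \in Q) S).

Definition crs (R : realType) (E : finType) (M : matroid E) : Type :=
  fdist R {set E} -> crm R M.

Definition ro_crs (R : realType) (E : finType) (M : matroid E)
    (phi : crs R M) : Prop :=
  forall rho, ro_crm (phi rho).

Definition universal (R : realType) (E : finType) (M : matroid E)
    (beta alpha : R) (phi : crs R M) : Prop :=
  forall rho : fdist R {set E},
    uncontentious M alpha rho -> balanced beta (phi rho) rho.

(* Main.v *)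
(* The weighted rank of a matroid decomposes along upper level sets, so a
   distribution is uncontentious exactly when expected ranks are large. By the
   minimax theorem, a contention resolution map balanced for a prior exists as
   soon as every nonnegative weighting admits a good one. From a secretary
   algorithm, a good one for the weights [y] is the algorithm run on [y]
   restricted to the active elements.

   For the converse, minimax reduces the secretary problem for finitely many
   weight vectors to a known (correlated) prior on them; behaviours being
   compact, an ultrafilter limit over finite sets of weight vectors then handles
   all weight vectors at once. Given a prior, sample each element with
   probability [m / (m + 1)]; the unsampled elements that are not spanned by
   heavier sampled ones form an uncontentious random set that retains a fraction
   [1 / (m + 1)] of the rank. Balance of a scheme for this set is not enough,
   since acceptance may be correlated with the weights. Hence replace every
   element by [N] parallel copies for each weight vector, activate only a uniform
   copy carrying the weight revealed, and use a scheme for this larger matroid.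
   To run it online, fix the order of all copies in advance and let an arriving
   element activate its copy of rank [r], where ranks increase along the
   arrivals. This is faithful unless two active copies appear in the wrong order,
   which has probability [O(1 / sqrt N)] for each pair of elements: in a random
   order, the numbers of copies of two elements preceding a given copy differ by
   [O(sqrt N)] in quadratic mean. *)
From HB Require Import structures.
Require Import Defs.
From mathcomp Require Import all_boot all_order all_algebra all_fingroup.
From mathcomp Require Import all_classical all_reals all_analysis.
From mathcomp Require Import fintype finset zify ring lra.

Set Implicit Arguments.
Unset Strict Implicit.
Unset Printing Implicit Defensive.

Import Order.TTheory GRing.Theory Num.Theory.

Local Open Scope ring_scope.

(** * A minimax theorem *)

(** The midpoint between the largest [lo] and the smallest [up] works. The default 0 of the maximum
    makes [t] nonnegative, and the default [m + 1] of the minimum covers an empty [B]. *)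
Lemma between_finite (R : realFieldType) (A B : finType) (lo : A -> R)
    (up : B -> R) :
  (forall b, 0 < up b) -> (forall a b, lo a < up b) ->
  exists2 t, 0 <= t & (forall a, lo a < t) /\ (forall b, t < up b).
Proof.
move=> up0 lou.
pose m : R := \big[Num.max/0]_a lo a.
have m0 : 0 <= m by rewrite /m; elim/big_rec: _ => // a x _ x0; rewrite le_max x0 orbT.
have mge a : lo a <= m by rewrite /m (bigD1 a) //= le_max lexx.
have mup b : m < up b.
  by rewrite /m; elim/big_rec: _ => // a x _ x0; rewrite gt_max lou x0.
pose M : R := \big[Num.min/m + 1]_b up b.
have mM : m < M.
  rewrite /M; elim/big_rec: _ => [|b x _ x0]; first by rewrite ltrDl.
  by rewrite lt_min mup x0.
have Mle b : M <= up b by rewrite /M (bigD1 b) //= ge_min lexx.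
exists ((m + M) / 2); first by lra.
split=> [a|b]; first by have := mge a; lra.
by have := Mle b; lra.
Qed.

(* Fourier-Motzkin elimination of the last constraint. *)
Lemma ville (R : realFieldType) (n : nat) (D : finType) (a : D -> nat -> R) :
  (exists p : D -> R, [/\ forall d, 0 <= p d, exists d, 0 < p d &
     forall i, (i < n)%N -> 0 <= \sum_d p d * a d i]) \/
  (exists2 y : nat -> R, forall i, 0 <= y i &
     forall d, \sum_(i < n) y i * a d i < 0).
Proof.
elim: n D a => [|n IH] D a.
  case: (pickP (fun _ : D => true)) => [d _|D0]; last first.
    by right; exists (fun=> 0) => // d; have := D0 d.
  by left; exists (fun=> 1); split => //; exists d.
(* The rows of the eliminated system are those with nonnegative last entry and, for every two rows
   with last entries of opposite signs, the positive combination whose last entry vanishes. *)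
pose P := {d : D | 0 <= a d n}.
pose N := {x : D * D | (0 < a x.1 n) && (a x.2 n < 0)}.
pose cf (z : P + N) (d : D) : R := match z with
  | inl x => (d == val x)%:R
  | inr x => a (val x).1 n * (d == (val x).2)%:R
             - a (val x).2 n * (d == (val x).1)%:R end.
have cf0 z d : 0 <= cf z d.
  case: z => [x|[x xN]] /=; first exact: ler0n.
  have /andP[x1 x2] := xN.
  by rewrite addr_ge0 // ?oppr_ge0 ?mulr_ge0 ?mulr_le0_ge0 ?ler0n // ltW.
pose a' z i := \sum_d cf z d * a d i.
have a'l x i : a' (inl x) i = a (val x) i.
  rewrite /a' (bigD1 (val x)) //= eqxx mul1r big1 ?addr0 // => d dx.
  by rewrite (negPf dx) mul0r.
have a'r x i : a' (inr x) i =
    a (val x).1 n * a (val x).2 i - a (val x).2 n * a (val x).1 i.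
  rewrite /a' /=.
  under eq_bigr => d _ do rewrite mulrBl -!mulrA.
  rewrite big_split /= sumrN -!mulr_sumr.
  rewrite (bigD1 (val x).2) //= eqxx mul1r [X in a _ n * (_ + X)]big1; last first.
    by move=> d dx; rewrite (negPf dx) mul0r.
  rewrite (bigD1 (val x).1) //= eqxx mul1r [X in _ - a _ n * (_ + X)]big1 ?addr0 //.
  by move=> d dx; rewrite (negPf dx) mul0r.
case: (IH _ a') => [[p [p0 [z0 pz0] pa]]|[y y0 ya]].
  left; exists (fun d => \sum_z p z * cf z d).
  have sumE i : \sum_d (\sum_z p z * cf z d) * a d i = \sum_z p z * a' z i.
    under eq_bigr => d _ do rewrite mulr_suml.
    rewrite exchange_big /=; apply: eq_bigr => z _.
    by rewrite /a' mulr_sumr; apply: eq_bigr => d _; rewrite mulrA.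
  split.
  - by move=> d; apply: sumr_ge0 => z _; rewrite mulr_ge0.
  - have [d cd] : exists d, 0 < cf z0 d.
      case: (z0) => [x|[x xN]].
        by exists (val x); rewrite /= eqxx.
      have /andP[x1 x2] := xN.
      exists x.2; rewrite /= eqxx mulr1.
      case: eqP => [e|_]; last by rewrite mulr0 subr0.
      by rewrite mulr1; lra.
    exists d; rewrite (bigD1 z0) //=; apply: ltr_pwDl; first by rewrite mulr_gt0.
    by apply: sumr_ge0 => z _; rewrite mulr_ge0.
  - move=> i; rewrite ltnS leq_eqVlt sumE => /orP[/eqP ->|]; last exact: pa.
    apply: sumr_ge0 => -[x|x] _; rewrite mulr_ge0 // ?a'l ?a'r.
      exact: (valP x).
    by rewrite mulrC subrr.
right.
pose f d := \sum_(i < n) y i * a d i.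
have fl (x : P) : f (val x) < 0.
  by have := ya (inl x); under eq_bigr do rewrite a'l.
have fr (x : N) : a (val x).1 n * f (val x).2 < a (val x).2 n * f (val x).1.
  rewrite -subr_lt0; have := ya (inr x); congr (_ < _).
  rewrite /f !mulr_sumr -sumrB; apply: eq_bigr => i _; rewrite a'r; ring.
have up0 (x : {d | 0 < a d n}) : 0 < - f (val x) / a (val x) n.
  case: x => d dn /=; have h : 0 <= a d n by rewrite ltW.
  by rewrite divr_gt0 // oppr_gt0; exact: (fl (exist _ d h)).
have lou (x : {d | a d n < 0}) (z : {d | 0 < a d n}) :
    f (val x) / - a (val x) n < - f (val z) / a (val z) n.
  case: x z => [e en] [d dn] /=.
  have h : (0 < a (d, e).1 n) && (a (d, e).2 n < 0) by rewrite /= dn en.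
  have := fr (exist _ (d, e) h) => /= {}h.
  rewrite ltr_pdivrMr ?oppr_gt0 // mulrAC ltr_pdivlMr //; lra.
(* The multiplier [t] of the last constraint must make [f d + t * a d n] negative: an upper bound
   for each positive [a d n], a lower bound for each negative one. *)
have [t t0 [tlo tup]] := between_finite up0 lou.
exists (fun i => if i == n then t else y i); first by move=> i; case: ifP.
move=> d; rewrite big_ord_recr /= eqxx.
rewrite (eq_bigr (fun i : 'I_n => y i * a d i)); last first.
  by move=> i _; rewrite ltn_eqF.
rewrite -/(f d); case: (ltrgt0P (a d n)) => dn.
- have := tup (exist _ d dn); rewrite /= ltr_pdivlMr //; lra.
- have := tlo (exist _ d dn); rewrite /= ltr_pdivrMr ?oppr_gt0 //; lra.
- have h : 0 <= a d n by rewrite dn.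
  by rewrite dn mulr0 addr0; exact: (fl (exist _ d h)).
Qed.

(** The second alternative of [ville] contradicts the hypothesis; the first gives a nonzero [p],
    which is then normalised. *)
Lemma minimax (R : realFieldType) (D I : finType) (a : D -> I -> R) :
  (forall y : I -> R, (forall i, 0 <= y i) ->
     exists d, 0 <= \sum_i y i * a d i) ->
  exists p : D -> R, [/\ forall d, 0 <= p d, \sum_d p d = 1 &
    forall i, 0 <= \sum_d p d * a d i].
Proof.
move=> H.
pose b d (k : nat) := if insub k is Some j then a d (enum_val (j : 'I_#|I|)) else 0.
have bE d i : b d (enum_rank i) = a d i by rewrite /b valK enum_rankK.
case: (ville #|I| b) => [[p [p0 [d0 pd0] pb]]|[y y0 yb]].
  pose s := \sum_d p d.
  have s0 : 0 < s.
    by rewrite /s (bigD1 d0) //= ltr_pwDl // sumr_ge0.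
  exists (fun d => p d / s); split.
  - by move=> d; rewrite divr_ge0 // ltW.
  - by rewrite -mulr_suml divff // gt_eqF.
  - move=> i; under eq_bigr do rewrite mulrAC.
    rewrite -mulr_suml divr_ge0 ?(ltW s0) //.
    by have := pb _ (ltn_ord (enum_rank i)); under eq_bigr do rewrite bE.
have [d] := H (fun i => y (enum_rank i)) (fun i => y0 _).
rewrite leNgt; have := yb d; suff -> : \sum_(i < #|I|) y i * b d i =
  \sum_i y (enum_rank i) * a d i by move=> ->.
rewrite [RHS](reindex_onto (@enum_val I I) enum_rank) /=; last first.
  by move=> i _; rewrite enum_rankK.
rewrite [RHS](eq_bigl xpredT); last by move=> i; rewrite enum_valK eqxx.
by apply: eq_bigr => i _; rewrite -bE enum_valK.
Qed.

(** Strategies may form an infinite type, but payoffs see only finitely many codes. [minimax] is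
    applied to the codes that occur, and its solution is extended by zero. *)
Lemma minimax_code (R : realFieldType) (D : Type) (F I : finType)
    (code : D -> F) (a : F -> I -> R) :
  (forall y : I -> R, (forall i, 0 <= y i) ->
     exists d, 0 <= \sum_i y i * a (code d) i) ->
  exists p : F -> R, [/\ forall f, 0 <= p f, \sum_f p f = 1,
    forall f, p f != 0 -> exists d, code d = f &
    forall i, 0 <= \sum_f p f * a f i].
Proof.
move=> H; pose C (f : F) : bool := `[< exists d, code d = f >].
have [|p [p0 p1 pa]] := @minimax R {f | C f} I (fun f => a (val f)).
  move=> y /H[d dP].
  have cd : C (code d) by apply/asboolP; exists d.
  by exists (exist (fun f => C f) (code d) cd).
pose q f := if insub f is Some x then p x else 0.
have qE (g : F -> R) : \sum_f q f * g f = \sum_x p x * g (val x).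
  rewrite (bigID C) /= [X in _ + X]big1 ?addr0; last first.
    by move=> f nf; rewrite /q insubN // mul0r.
  rewrite (reindex_omap (val : {f | C f} -> F) insub) /=; last first.
    by move=> f Cf; rewrite insubT.
  apply: eq_big => [x|x _]; first by rewrite valK eqxx (valP x).
  by rewrite /q valK.
exists q; split.
- by move=> f; rewrite /q; case: insubP.
- by have := qE (fun=> 1); rewrite -!mulr_suml !mulr1 p1.
- move=> f; rewrite /q; case: insubP => [x Cf _ _|]; last by rewrite eqxx.
  exact/asboolP.
- by move=> i; rewrite qE.
Qed.

(** * Greedy bases and uncontentious distributions *)

Section MatroidRank.
Variables (E : finType) (M : matroid E).
Implicit Types (A B C : {set E}) (e : E).

Definition rk A : nat := \max_(B in indep M | B \subset A) #|B|.

Lemma rk_ex A : exists B, [/\ B \in indep M, B \subset A & #|B| = rk A].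
Proof.
have [|B /andP[BM BA] BE] := @eq_bigmax_cond _
  [pred B | (B \in indep M) && (B \subset A)] (fun B => #|B|).
  by apply/card_gt0P; exists set0; rewrite inE indep0 sub0set.
by exists B; split=> //; rewrite -BE.
Qed.

Lemma leq_rk A B : B \in indep M -> B \subset A -> (#|B| <= rk A)%N.
Proof. by move=> BM BA; rewrite /rk (bigop.bigmax_sup B) ?BM. Qed.

Lemma rkS A B : A \subset B -> (rk A <= rk B)%N.
Proof.
move=> AB; have [C [CM CA <-]] := rk_ex A.
by rewrite leq_rk // (subset_trans CA).
Qed.

Lemma rk_indep A : A \in indep M -> rk A = #|A|.
Proof.
move=> AM; apply/eqP; rewrite eqn_leq leq_rk // andbT.
by have [B [_ BA <-]] := rk_ex A; exact: subset_leq_card.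
Qed.

Lemma basis_extend A B : B \in indep M -> B \subset A ->
  exists C, [/\ B \subset C, C \subset A, C \in indep M & #|C| = rk A].
Proof.
move=> BM BA.
have [n] := ubnP (rk A - #|B|)%N; elim: n B BM BA => // n IH B BM BA le_n.
have [ge|lt] := leqP (rk A) #|B|.
  by exists B; split=> //; apply/eqP; rewrite eqn_leq ge leq_rk.
have [C [CM CA Cr]] := rk_ex A.
have [|e] := indep_exchange BM CM; first by rewrite Cr.
rewrite inE => /andP[eB eC] eBM.
have eBA : e |: B \subset A by rewrite subUset sub1set (subsetP CA).
have cB : #|e |: B| = #|B|.+1 by rewrite cardsU1 eB.
have [|C' [BC' C'A C'M C'r]] := IH _ eBM eBA; first by rewrite cB; lia.
by exists C'; split=> //; apply: subset_trans BC'; exact: subsetUr.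
Qed.

Definition spans A e := rk (e |: A) == rk A.

(** If [e] raises the rank of [B], exchange adds it to a basis of [B] that extends a basis of [A];
    by heredity [e] then raises the rank of [A] too. *)
Lemma spansS A B e : A \subset B -> spans A e -> spans B e.
Proof.
move=> AB; apply: contraTT => nB.
have [C [CM CA Cr]] := rk_ex A.
have [C' [CC' C'B C'M C'r]] := basis_extend CM (subset_trans CA AB).
have [D [DM DB Dr]] := rk_ex (e |: B).
have ltB : (rk B < rk (e |: B))%N.
  by rewrite ltn_neqAle eq_sym nB rkS // subsetUr.
have [|x] := indep_exchange C'M DM; first by rewrite C'r Dr.
rewrite inE => /andP[xC' xD] xM.
have [xB|xnB] := boolP (x \in B).
  have := leq_rk xM (A := B); rewrite subUset sub1set xB C'B => /(_ isT).
  by rewrite cardsU1 xC' C'r add1n ltnn.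
have xe : x = e.
  by have := subsetP DB x xD; rewrite !inE (negPf xnB) orbF => /eqP.
move: xC' xM; rewrite xe => eC' eM.
have eCM : e |: C \in indep M.
  by apply: indep_hereditary eM; exact: setUS.
have : (#|e |: C| <= rk (e |: A))%N by rewrite leq_rk // setUS.
rewrite cardsU1 (contra (subsetP CC' e) eC') Cr add1n => h.
by rewrite /spans neq_ltn h orbT.
Qed.

Lemma rkU1 A e : rk (e |: A) = (rk A + ~~ spans A e)%N.
Proof.
have := rkS (subsetUr [set e] A).
have [B [BM BA Br]] := rk_ex (e |: A).
have : (#|B :\ e| <= rk A)%N.
  rewrite leq_rk //; first by apply: indep_hereditary BM; exact: subsetDl.
  by rewrite subDset.
have : (#|B| <= #|B :\ e|.+1)%N by rewrite (cardsD1 e B); case: (e \in B).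
by rewrite /spans -Br; case: eqP; lia.
Qed.

Lemma indepU1 A e : A \in indep M -> ~~ spans A e -> e |: A \in indep M.
Proof.
move=> AM nsp; have [B [BM BA Br]] := rk_ex (e |: A).
suff -> : e |: A = B by [].
apply/eqP; rewrite eq_sym eqEcard BA /= Br rkU1 nsp rk_indep // cardsU1.
by rewrite addnC leq_add2l; case: (e \in A).
Qed.

Section Greedy.
Variable o : E -> nat.
Hypothesis o_inj : injective o.

Definition before e := [set e' | (o e' < o e)%N].

(** The output of the greedy algorithm in closed form: testing against all earlier elements of [A],
    not just the selected ones, avoids a recursion. *)
Definition greedy A := [set e in A | ~~ spans (A :&: before e) e].

Lemma greedy_sub A : greedy A \subset A.
Proof. by apply/subsetP => e; rewrite inE => /andP[]. Qed.

(** Remove the last element [m] of [A]: it is selected exactly when it raises the rank, and the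
    other selections do not see it. *)
Lemma greedyP A : greedy A \in indep M /\ #|greedy A| = rk A.
Proof.
have [n] := ubnP #|A|; elim: n A => // n IH A le_n.
have [->|[x0 x0A]] := set_0Vmem A.
  have -> : greedy set0 = set0 by apply/setP => e; rewrite !inE.
  by rewrite indep0 rk_indep ?indep0.
pose m := [arg max_(x > x0 in A) o x].
have [mA mmax] : m \in A /\ forall x, x \in A -> (o x <= o m)%N.
  by rewrite /m; case: arg_maxnP.
have AE : A = m |: (A :\ m) by rewrite setD1K.
have Abm : A :&: before m = A :\ m.
  apply/setP => x; rewrite !inE; case xA : (x \in A); rewrite ?andbF //= andbT.
  by rewrite ltn_neqAle mmax // andbT (inj_eq o_inj).
have gE : greedy A = (if spans (A :\ m) m then set0 else [set m]) :|: greedy (A :\ m).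
  apply/setP => x; rewrite /greedy 3!inE; have [->|xm] := eqVneq x m.
    by rewrite mA /= Abm; case: ifP => h; rewrite !inE ?h ?eqxx.
  have -> : (x \in if spans (A :\ m) m then set0 else [set m]) = false.
    by case: ifP; rewrite !inE ?(negPf xm).
  rewrite /= !inE xm /=; case xA : (x \in A) => //=; congr (~~ spans _ _).
  apply/setP => z; rewrite !inE; have [->|//] := eqVneq z m.
  by rewrite mA /= ltnNge mmax.
have [|iM ic] := IH (A :\ m).
  by move: le_n; rewrite (cardsD1 m A) mA.
have rkA : rk A = (rk (A :\ m) + ~~ spans (A :\ m) m)%N by rewrite {1}AE rkU1.
rewrite gE rkA; case: ifP => h /=; first by rewrite set0U addn0.
have mg : m \notin greedy (A :\ m) by rewrite !inE eqxx.
split; last by rewrite cardsU1 mg ic addnC.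
apply: indepU1 => //.
apply: contraFN h; exact: spansS (greedy_sub _).
Qed.

(** Whatever precedes an element of the initial segment [U] lies in [U]. With upper level sets as
    [U], the greedy set contains a basis of each level at once. *)
Lemma greedyI A (U : {set E}) :
  (forall e e', e \in U -> (o e' < o e)%N -> e' \in U) ->
  greedy A :&: U = greedy (A :&: U).
Proof.
move=> dU; apply/setP => e; rewrite !inE andbAC.
case eU : (e \in U); rewrite ?andbF //= !andbT.
congr (_ && ~~ spans _ _).
apply/setP => z; rewrite !inE; case: (ltnP (o z) (o e)) => h; rewrite ?andbF //.
by rewrite (dU _ _ eU h) !andbT.
Qed.

End Greedy.
End MatroidRank.

(** * Decreasing weight orders and level sets *)

Section WeightOrder.
Variables (R : realType) (E : finType) (w : E -> R).

(* Decreasing weight, ties broken by the enumeration of [E]: whether [e'] is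
   heavier than [e] depends on the weights of these two elements only. *)
Definition heavier (e' e : E) : bool :=
  (w e < w e') || ((w e == w e') && (enum_rank e' < enum_rank e)%N).

Definition worder (e : E) : nat := #|[set e' | heavier e' e]|.

Lemma heavier_irr e : heavier e e = false.
Proof. by rewrite /heavier ltxx eqxx ltnn. Qed.

Lemma heavier_trans : transitive heavier.
Proof.
move=> y x z; rewrite /heavier => /orP[xy|/andP[/eqP xy rxy]].
  by case/orP => [yz|/andP[/eqP -> _]]; rewrite ?xy ?(lt_trans yz xy).
case/orP => [yz|/andP[/eqP yz ryz]]; first by rewrite -xy yz.
by rewrite yz xy eqxx (ltn_trans rxy ryz) orbT.
Qed.

Lemma heavier_total e e' : e != e' -> heavier e e' || heavier e' e.
Proof.
move=> ee'; rewrite /heavier; case: (ltgtP (w e) (w e')) => //= _.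
have : enum_rank e != enum_rank e' :> nat.
  by apply: contra_neq ee' => /val_inj /enum_rank_inj.
by case: ltngtP.
Qed.

Lemma worderE e' e : (worder e' < worder e)%N = heavier e' e.
Proof.
have mono x y : heavier x y -> (worder x < worder y)%N.
  move=> xy; apply: proper_card; apply/properP; split.
    by apply/subsetP => z; rewrite !inE => /heavier_trans; exact.
  by exists x; rewrite !inE ?heavier_irr.
apply/idP/idP => [lt|/mono //].
have [ee'|ne] := eqVneq e' e; first by rewrite ee' ltnn in lt.
have /orP[//|/mono] := heavier_total ne.
by move/(ltn_trans lt); rewrite ltnn.
Qed.

Lemma worder_inj : injective worder.
Proof.
move=> x y xy; apply/eqP; apply/negPn/negP => /heavier_total.
by rewrite -!worderE xy ltnn.
Qed.

Lemma worder_upper (t : R) e e' :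
  t <= w e -> (worder e' < worder e)%N -> t <= w e'.
Proof.
rewrite worderE /heavier => te /orP[h|/andP[/eqP <- //]].
exact: le_trans te (ltW h).
Qed.

(* Abel summation over the upper level sets of [w]. *)
Lemma upper_sum_ge0 (mu : E -> R) : (forall e, 0 <= w e) ->
  (forall t, 0 < t -> 0 <= \sum_(e | t <= w e) mu e) ->
  0 <= \sum_e w e * mu e.
Proof.
have [n] := ubnP #|[set e | 0 < w e]|.
elim: n w => // n IH v le_n v0 muv.
have [V0|[x0 x0V]] := set_0Vmem [set e | 0 < v e].
  rewrite big1 // => e _.
  suff -> : v e = 0 by rewrite mul0r.
  apply/eqP; rewrite eq_le v0 andbT leNgt; apply/negP => ve.
  by have := in_set0 e; rewrite -V0 inE ve.
have [m mV mmin] : exists2 m, 0 < v m & forall x, 0 < v x -> v m <= v x.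
  rewrite inE in x0V.
  by case: (@arg_minP _ _ _ x0 (fun x => 0 < v x) v x0V) => m mV mmin; exists m.
(* Lowering all positive weights by the least one leaves fewer positive weights, and the level set
   of [v'] at [t > 0] is that of [v] at [t + v m]. *)
pose v' e := if 0 < v e then v e - v m else 0.
have v'0 e : 0 <= v' e.
  by rewrite /v'; case: ifP => // /mmin; rewrite subr_ge0.
have h1 : 0 <= \sum_e v' e * mu e.
  apply: IH => //.
    rewrite -ltnS; apply: leq_trans le_n; rewrite ltnS; apply: proper_card.
    apply/properP; split.
      apply/subsetP => e; rewrite !inE /v'; case: ifP => //; by rewrite ltxx.
    by exists m; rewrite !inE // /v' mV subrr ltxx.
  move=> t t0; rewrite (eq_bigl (fun e => t + v m <= v e)).
    by apply: muv; rewrite addr_gt0.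
  move=> e; rewrite /v'; case: ifPn => [_|]; first by rewrite lerBrDr.
  rewrite -leNgt => ve; rewrite [LHS]leNgt t0 /=; apply/esym/negbTE.
  by rewrite -ltNge; lra.
have -> : \sum_e v e * mu e =
    \sum_e v' e * mu e + v m * \sum_(e | v m <= v e) mu e.
  rewrite [X in _ + _ * X]big_mkcond mulr_sumr -big_split /=.
  apply: eq_bigr => e _; rewrite /v'.
  have [ve|ve] := boolP (0 < v e).
    by rewrite mmin //; ring.
  have -> : (v m <= v e) = false.
    by apply/negbTE; rewrite -ltNge; move: ve; rewrite -leNgt; lra.
  suff -> : v e = 0 by ring.
  by apply/eqP; rewrite eq_le v0 andbT leNgt.
by rewrite addr_ge0 // mulr_ge0 ?(ltW mV) // muv.
Qed.

End WeightOrder.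

Section Rank.
Variables (R : realType) (E : finType) (M : matroid E).
Implicit Types (w : E -> R) (A S : {set E}).

Lemma sum_indic (I : finType) (P : pred I) (f : I -> R) :
  \sum_(e | P e) f e = \sum_e f e * (P e)%:R.
Proof.
by rewrite big_mkcond; apply: eq_bigr => e _; case: (P e); rewrite ?mulr1 ?mulr0.
Qed.

Lemma sum_card (S : {set E}) (P : pred E) :
  \sum_(e | P e) (e \in S)%:R = #|S :&: [set e | P e]|%:R :> R.
Proof.
rewrite -sum1_card natr_sum (big_mkcond P) [RHS]big_mkcond /=.
by apply: eq_bigr => e _; rewrite !inE; case: (e \in S); case: (P e).
Qed.

Lemma weightE w S : weight w S = \sum_e w e * (e \in S)%:R.
Proof. exact: sum_indic. Qed.

Lemma weight_le_rank w S : S \in indep M -> weight w S <= rank M w.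
Proof. by move=> SM; rewrite /rank (bigD1 S) //= le_max lexx. Qed.

Lemma rank_ge0 w : 0 <= rank M w.
Proof. by rewrite /rank; elim/big_rec: _ => // S x _ x0; rewrite le_max x0 orbT. Qed.

(** Abel summation reduces the comparison to level sets, where the greedy set traces a basis and any
    competitor an independent set. *)
Lemma rank_le_greedy w : (forall e, 0 <= w e) ->
  rank M w <= weight w (greedy M (worder w) setT).
Proof.
move=> w0; have gw : 0 <= weight w (greedy M (worder w) setT).
  by apply: sumr_ge0 => e _.
rewrite /rank; elim/big_rec: _ => // S x SM x0; rewrite ge_max x0 andbT.
rewrite -subr_ge0 !weightE -sumrB.
under eq_bigr do rewrite -mulrBr.
apply: upper_sum_ge0 => // t t0; rewrite sumrB !sum_card subr_ge0 ler_nat.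
rewrite greedyI; last by move=> e e'; rewrite !inE; exact: worder_upper.
have [_ ->] := greedyP M (@worder_inj _ _ w) (setT :&: [set e | t <= w e]).
by rewrite setTI leq_rk ?subsetIr // (indep_hereditary (subsetIl _ _)).
Qed.

(** By minimax over deterministic offline maps, each weighting [y] may be treated separately. The
    greedy map for [y] suffices: Abel summation reduces its payoff to the hypothesis for the level
    sets [Z] of [y]. *)
Lemma uncontentious_rk (alpha : R) (rho : fdist R {set E}) :
  (forall Z : {set E}, alpha * (\sum_Q rho Q * #|Q :&: Z|%:R) <=
     \sum_Q rho Q * (rk M (Q :&: Z))%:R) ->
  uncontentious M alpha rho.
Proof.
move=> H.
pose D := {d : {set E} -> {set E} | forall Q, (d Q \subset Q) && (d Q \in indep M)}.
pose code (d : D) : {ffun {set E} -> {set E}} := [ffun Q => sval d Q].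
pose a (f : {ffun {set E} -> {set E}}) i :=
  \sum_Q rho Q * ((i \in f Q)%:R - alpha * (i \in Q)%:R).
have [y y0|p [p0 p1 pD pa]] := @minimax_code R D _ E code a.
  have gP Q : (greedy M (worder y) Q \subset Q) &&
      (greedy M (worder y) Q \in indep M).
    by rewrite greedy_sub; have [] := greedyP M (@worder_inj _ _ y) Q.
  exists (exist _ (greedy M (worder y)) gP).
  apply: upper_sum_ge0 => // t t0.
  rewrite exchange_big /=; under eq_bigr => Q _.
    rewrite -mulr_sumr sumrB -mulr_sumr !sum_card ffunE /=.
    rewrite greedyI; last by move=> e e'; rewrite !inE; exact: worder_upper.
    have [_ ->] := greedyP M (@worder_inj _ _ y) (Q :&: [set e | t <= y e]).
    rewrite mulrBr mulrCA.
  over.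
  by rewrite sumrB -mulr_sumr subr_ge0.
pose law Q S : R := \sum_f p f * (f Q == S)%:R.
have law0 Q S : 0 <= law Q S by apply: sumr_ge0 => f _; rewrite mulr_ge0.
have lawE Q (g : {set E} -> R) : \sum_S law Q S * g S = \sum_f p f * g (f Q).
  under eq_bigr do rewrite mulr_suml.
  rewrite exchange_big /=; apply: eq_bigr => f _.
  rewrite (bigD1 (f Q)) //= eqxx mulr1 big1 ?addr0 // => S SQ.
  by rewrite eq_sym (negPf SQ) mulr0 mul0r.
have law1 Q : \sum_S law Q S = 1.
  by have := lawE Q (fun=> 1); rewrite -!mulr_suml !mulr1 p1.
pose phi0 Q := Fdist (law0 Q) (law1 Q).
have sup Q S : phi0 Q S != 0 -> (S \subset Q) && (S \in indep M).
  move=> h; have [f] : exists f, p f * (f Q == S)%:R != 0.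
    apply/existsP; apply: contraNT h; rewrite negb_exists => /forallP h.
    by apply/eqP; apply: big1 => f _; have := h f; rewrite negbK => /eqP.
  rewrite mulf_eq0 negb_or => /andP[/pD[d <-]].
  case: (code d Q =P S) => [<- _|_]; last by rewrite eqxx.
  by rewrite ffunE; exact: (svalP d).
have E1 i : \sum_Q rho Q * \sum_(S : {set E} | i \in S) phi0 Q S =
    \sum_f p f * \sum_Q rho Q * (i \in f Q)%:R.
  under eq_bigr do rewrite sum_indic lawE mulr_sumr.
  rewrite exchange_big; apply: eq_bigr => f _; rewrite mulr_sumr.
  by apply: eq_bigr => Q _; rewrite mulrCA.
have E2 f i : a f i = \sum_Q rho Q * (i \in f Q)%:R -
    alpha * \sum_(Q : {set E} | i \in Q) rho Q.
  rewrite /a [X in _ = _ - _ * X]sum_indic mulr_sumr -sumrB; apply: eq_bigr => Q _.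
  by rewrite mulrBr; congr (_ - _); rewrite mulrCA.
exists (Crm sup) => i; rewrite -subr_ge0 E1.
have := pa i; under eq_bigr do rewrite E2 mulrBr.
by rewrite sumrB -mulr_suml p1 mul1r.
Qed.

End Rank.

(** * Online policies *)

Section Histories.
Variables (E : finType) (X : Type).
Implicit Types (d : seq (E * X) -> bool) (h : seq (E * X)).

(** Unlike [accepted], this makes sense for partial histories, so that acceptance can be followed
    one arrival at a time. *)
Definition acc d h : {set E} :=
  [set e in unzip1 h | d (take (index e (unzip1 h)).+1 h)].

Lemma acc_nil d : acc d [::] = set0.
Proof. by apply/setP => e; rewrite !inE. Qed.

Lemma acc_sub d h : acc d h \subset [set e in unzip1 h].
Proof. by apply/subsetP => e; rewrite !inE => /andP[]. Qed.

Lemma acc_rcons d h p : p.1 \notin unzip1 h ->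
  acc d (rcons h p) = if d (rcons h p) then p.1 |: acc d h else acc d h.
Proof.
move=> ph.
have accE e : e \in unzip1 h -> (e \in acc d (rcons h p)) = (e \in acc d h).
  move=> eh; rewrite !inE /unzip1 map_rcons mem_rcons inE -/(unzip1 h) eh orbT /=.
  rewrite -cats1 index_cat eh -cats1 take_cat.
  have lt : (index e (unzip1 h) < size h)%N by rewrite -(size_map fst) index_mem.
  case: ltnP => // ge; rewrite (_ : (_ - _ = 0)%N) ?take0 ?cats0; last by lia.
  by rewrite take_oversize.
have accP : (p.1 \in acc d (rcons h p)) = d (rcons h p).
  rewrite !inE /unzip1 map_rcons mem_rcons inE eqxx /= -cats1 index_cat.
  rewrite -/(unzip1 h) (negPf ph) /= eqxx addn0 size_map take_oversize //.
  by rewrite size_rcons.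
apply/setP => e; have [->|ep] := eqVneq e p.1.
  rewrite accP; case: ifP; rewrite ?setU11 // !inE (negPf ph) //.
have -> : (e \in (if d (rcons h p) then p.1 |: acc d h else acc d h)) =
    (e \in acc d h) by case: ifP; rewrite // in_setU1 (negPf ep).
have [/accE //|eh] := boolP (e \in unzip1 h).
by rewrite !inE /unzip1 map_rcons mem_rcons inE (negPf ep) -/(unzip1 h) (negPf eh).
Qed.

Definition hist (x : E -> X) (s : {perm E}) : seq (E * X) :=
  [seq (a, x a) | a <- arrival_order s].

Lemma unzip1_hist x s : unzip1 (hist x s) = arrival_order s.
Proof. by rewrite /unzip1 -map_comp map_id. Qed.

Lemma arrival_uniq (s : {perm E}) : uniq (arrival_order s).
Proof. by rewrite map_inj_uniq ?enum_uniq //; exact: perm_inj. Qed.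

Lemma mem_arrival (s : {perm E}) e : e \in arrival_order s.
Proof. by rewrite -(permKV s e) map_f // mem_enum. Qed.

Lemma mem_acc_hist d x s e : (e \in acc d (hist x s)) =
  d [seq (a, x a) | a <- take (index e (arrival_order s)).+1 (arrival_order s)].
Proof. by rewrite inE unzip1_hist mem_arrival map_take. Qed.

Lemma accepted_acc (R : realType) (A : policy R E X) x s (u : seed A) :
  accepted x s u = acc (accept u) (hist x s).
Proof. by apply/setP => e; rewrite mem_acc_hist inE. Qed.

(* [P h S] plays the role of the probability that exactly [S] has been accepted
   after the arrivals [h]. *)
Record behaviour (R : realType) (P : seq (E * X) -> {set E} -> R) : Prop :=
  Behaviour {
    behaviour_ge0 : forall h S, 0 <= P h S;
    behaviour_nil : P [::] set0 = 1;
    behaviour_rcons : forall h p (S : {set E}), p.1 \notin unzip1 h ->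
      S \subset [set e in unzip1 h] ->
      P (rcons h p) S + P (rcons h p) (p.1 |: S) = P h S }.

End Histories.

Lemma unit_itv_setT (R : realType) :
  mrestr (@lebesgue_measure R) (measurable_itv `[0, 1[) classical_sets.setT = 1%E.
Proof.
by rewrite /mrestr classical_sets.setTI lebesgue_measure_itv /= lte_fin ltr01 oppr0 addr0.
Qed.

HB.instance Definition _ (R : realType) := Measure_isProbability.Build _ _ R
  (mrestr (@lebesgue_measure R) (measurable_itv `[0, 1[)) (@unit_itv_setT R).

(* The seed is a uniform point of [[0, 1)]; the event that [S] has been accepted
   after [h] is an interval of length [P h S], which the next arrival splits in
   two. Histories are reversed here. *)
Section Realize.
Variables (R : realType) (E : finType) (X : Type).
Variable P : seq (E * X) -> {set E} -> R.
Hypothesis PB : behaviour P.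
Implicit Types (g : seq (E * X)) (S T : {set E}) (u : R).

(** The left half of an interval rejects the newest element and the right half accepts it, hence the
    shift when [p.1 \in S]. *)
Fixpoint left_end g S : R :=
  if g is p :: g' then
    left_end g' (S :\ p.1) + (if p.1 \in S then P (rev g) (S :\ p.1) else 0)
  else 0.

Fixpoint state u g : {set E} :=
  if g is p :: g' then
    let S := state u g' in
    if u < left_end g' S + P (rev g) S then S else p.1 |: S
  else set0.

(** Feasibility is required for every seed, while the seed space is the whole real line. Seeds
    [u >= 1] accept nothing by the first test; negative ones end in the empty set by [state_neg]. *)
Definition interval_accept u (h : seq (E * X)) : bool :=
  (u < 1) && (if rev h is p :: g then
                ~~ (u < left_end g (state u g) + P h (state u g)) else false).

Lemma left_end_ge0 g S : 0 <= left_end g S.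
Proof.
elim: g S => //= p g IH S; rewrite addr_ge0 //.
by case: ifP => // _; exact: behaviour_ge0.
Qed.

Lemma state_sub u g : state u g \subset [set e in unzip1 g].
Proof.
elim: g => /= [|p g IH]; first by rewrite sub0set.
have sub : [set e in unzip1 g] \subset [set e in p.1 :: unzip1 g].
  by apply/subsetP => e; rewrite !inE => ->; rewrite orbT.
have {}IH := subset_trans IH sub.
by case: ifP => // _; rewrite subUset IH sub1set !inE eqxx.
Qed.

Lemma state_neg u g : u < 0 -> state u g = set0.
Proof.
move=> u0; elim: g => //= p g ->; rewrite (lt_le_trans u0) //.
by rewrite addr_ge0 ?left_end_ge0 ?(behaviour_ge0 PB).
Qed.

(** The state can be [S] only if it was [S :\ p.1] before the last arrival, and by [behaviour_rcons]
    the intervals of the two possible successors tile the previous one. *)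
Lemma stateE u g S : uniq (unzip1 g) -> 0 <= u < 1 ->
  S \subset [set e in unzip1 g] ->
  (state u g == S) = (left_end g S <= u < left_end g S + P (rev g) S).
Proof.
move=> + /andP[u0 u1]; elim: g S => /= [S _|p g IH S /andP[pg ug]] Sg.
  have -> : S = set0.
    by apply/setP => e; rewrite inE; apply/negbTE/negP => /(subsetP Sg); rewrite inE.
  by rewrite eqxx u0 add0r (behaviour_nil PB).
have S0g : S :\ p.1 \subset [set e in unzip1 g].
  apply/subsetP => e; rewrite in_setD1 => /andP[ep /(subsetP Sg)].
  by rewrite !inE (negPf ep).
have prg : p.1 \notin unzip1 (rev g) by rewrite /unzip1 map_rev mem_rev.
have S0g' : S :\ p.1 \subset [set e in unzip1 (rev g)].
  apply/subsetP => e /(subsetP S0g); rewrite !inE.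
  by rewrite /unzip1 map_rev mem_rev.
have := behaviour_rcons PB prg S0g'; rewrite -rev_cons.
have := behaviour_ge0 PB (rev (p :: g)) (S :\ p.1).
have := behaviour_ge0 PB (rev (p :: g)) (p.1 |: S :\ p.1).
have := IH _ ug S0g.
set T := state u g; set l := left_end g (S :\ p.1).
set a := P (rev (p :: g)) (S :\ p.1); set b := P _ (p.1 |: _); set c := P (rev g) _.
move=> TE b0 a0 abc.
have pT : p.1 \notin T.
  by apply/negP => /(subsetP (state_sub u g)); rewrite inE (negPf pg).
have [TS|TS] := eqVneq T (S :\ p.1).
  move: TE; rewrite TS eqxx -/l -/a => /esym/andP[lu uc].
  case pS : (p.1 \in S).
    have SE : S = p.1 |: S :\ p.1 by rewrite setD1K.
    rewrite [P _ S](_ : _ = b); last by rewrite /b -SE.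
    case: ltP => h.
      by apply/negbTE/eqP => e; move: pS; rewrite -e !inE eqxx.
    by rewrite -SE eqxx -addrA abc uc.
  have SE : S :\ p.1 = S.
    by apply/setP => e; rewrite in_setD1; have [->|//] := eqVneq e p.1; rewrite pS.
  rewrite addr0 lu /= [P _ S](_ : _ = a); last by rewrite /a SE.
  case: ltP => h; first by rewrite SE eqxx.
  by apply/negbTE/eqP => e; move: pS; rewrite -e setU11.
have -> : ((if u < left_end g T + P (rev (p :: g)) T then T else p.1 |: T) == S) = false.
  apply/negbTE; apply: contra_neq TS; case: ifP => _ <-.
    apply/setP => e; rewrite in_setD1; have [->|//] := eqVneq e p.1.
    by rewrite (negPf pT).
  apply/setP => e; rewrite in_setD1 in_setU1; have [->|//] := eqVneq e p.1.
  by rewrite (negPf pT).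
move: TE; rewrite (negPf TS) => TE; apply/esym/negbTE; apply: contraFN (esym TE).
rewrite -/l; case pS : (p.1 \in S).
  have SE : S = p.1 |: S :\ p.1 by rewrite setD1K.
  rewrite [P _ S](_ : _ = b); last by rewrite /b -SE.
  by rewrite -addrA abc => /andP[h ->]; rewrite andbT (le_trans _ h) // lerDl.
have SE : S :\ p.1 = S.
  by apply/setP => e; rewrite in_setD1; have [->|//] := eqVneq e p.1; rewrite pS.
rewrite addr0 [P _ S](_ : _ = a); last by rewrite /a SE.
by move=> /andP[-> h] /=; rewrite (lt_le_trans h) // -abc addrA lerDl.
Qed.

(** Each interval lies inside that of its predecessor, the first one being [[0, 1)]. *)
Lemma right_end_le1 g S : uniq (unzip1 g) ->
  S \subset [set e in unzip1 g] -> left_end g S + P (rev g) S <= 1.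
Proof.
elim: g S => /= [S _ Sg|p g IH S /andP[pg ug] Sg].
  have -> : S = set0.
    by apply/setP => e; rewrite inE; apply/negbTE/negP => /(subsetP Sg); rewrite inE.
  by rewrite add0r (behaviour_nil PB).
have S0g : S :\ p.1 \subset [set e in unzip1 g].
  apply/subsetP => e; rewrite in_setD1 => /andP[ep /(subsetP Sg)].
  by rewrite !inE (negPf ep).
have prg : p.1 \notin unzip1 (rev g) by rewrite /unzip1 map_rev mem_rev.
have S0g' : S :\ p.1 \subset [set e in unzip1 (rev g)].
  apply/subsetP => e /(subsetP S0g); rewrite !inE.
  by rewrite /unzip1 map_rev mem_rev.
have abc := behaviour_rcons PB prg S0g'; rewrite -rev_cons in abc.
have b0 := behaviour_ge0 PB (rev (p :: g)) (p.1 |: S :\ p.1).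
apply: le_trans (IH _ ug S0g); rewrite -addrA lerD2l -abc.
case: ifPn => pS; first by rewrite setD1K.
rewrite add0r; suff -> : S :\ p.1 = S by rewrite lerDl (behaviour_ge0 PB).
by apply/setP => e; rewrite in_setD1; have [->|//] := eqVneq e p.1; rewrite (negPf pS).
Qed.

Lemma interval_accE u (h : seq (E * X)) : uniq (unzip1 h) ->
  acc (interval_accept u) h = if u < 1 then state u (rev h) else set0.
Proof.
elim/last_ind: h => [|h p IH]; first by rewrite acc_nil; case: ifP.
rewrite {1}/unzip1 map_rcons rcons_uniq => /andP[ph uh].
rewrite acc_rcons // IH // /interval_accept rev_rcons /=.
by case: (u < 1) => //=; rewrite rev_cons revK if_neg.
Qed.

Local Open Scope classical_set_scope.
Local Notation mR := (measurableTypeR R).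

Lemma measurable_exists_fin (T : finType) (A : T -> set mR) :
  (forall t, measurable (A t)) -> measurable (fun u => exists t, A t u).
Proof.
move=> mA; have -> : (fun u => exists t, A t u) =
    classical_sets.bigcup classical_sets.setT A.
  by apply/seteqP; split => u [t]; [exists t|move=> _; exists t].
by apply: fin_bigcup_measurable => [|t _]; [exact: finite_finset|exact: mA].
Qed.

Lemma measurable_lt_cst (a : R) : measurable ([set u | u < a] : set mR).
Proof.
by rewrite -set_itvNyo; exact: measurable_itv.
Qed.

Lemma measurable_prop (Q : Prop) : measurable ([set _ | Q] : set mR).
Proof.
have [q|q] := pselect Q.
  by rewrite (_ : [set _ | _] = classical_sets.setT) //; apply/seteqP; split.
by rewrite (_ : [set _ | _] = classical_sets.set0) //; apply/seteqP; split.
Qed.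

Lemma measurable_state g S : measurable ([set u | state u g = S] : set mR).
Proof.
elim: g S => /= [S|p g IH S]; first exact: measurable_prop.
pose A T : set mR := [set u | state u g = T] `&`
  (([set u | u < left_end g T + P (rev (p :: g)) T] `&` [set _ | T = S]) `|`
   (~` [set u | u < left_end g T + P (rev (p :: g)) T] `&` [set _ | p.1 |: T = S])).
rewrite (_ : [set _ | _] = (fun u => exists T, A T u)).
  apply: measurable_exists_fin => T; apply: measurableI; first exact: IH.
  apply: measurableU; apply: measurableI; rewrite -/(measurable _).
  - exact: measurable_lt_cst.
  - exact: measurable_prop.
  - by apply: measurableC; exact: measurable_lt_cst.
  - exact: measurable_prop.
apply/seteqP; split => u /=.
  move=> h; exists (state u g); split => //=.
  by move: h; case: ifP => h; [left|right; split => //; rewrite h].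
by case=> T [] /= -> [[-> //]|[/negP/negbTE ->]].
Qed.

Lemma measurable_interval_accept h :
  measurable ([set u | interval_accept u h] : set mR).
Proof.
rewrite /interval_accept.
rewrite (_ : [set _ | _] = [set u | u < 1] `&`
   [set u | if rev h is p :: g then
                ~~ (u < left_end g (state u g) + P h (state u g)) else false]).
  apply: measurableI; first exact: measurable_lt_cst.
  case: (rev h) => [|p g].
    rewrite (_ : [set _ | _] = classical_sets.set0) //.
    by apply/seteqP; split.
  pose A T : set mR := [set u | state u g = T] `&`
    ~` [set u | u < left_end g T + P h T].
  rewrite (_ : [set _ | _] = (fun u => exists T, A T u)).
    apply: measurable_exists_fin => T; apply: measurableI; first exact: measurable_state.
    by apply: measurableC; exact: measurable_lt_cst.
  apply/seteqP; split => u /=; first by move=> /negP h'; exists (state u g).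
  by case=> T [] /= -> /negP.
apply/seteqP; split => u /=; first by move/andP; case: (rev h).
by move=> uh; apply/andP; move: uh; case: (rev h).
Qed.

Lemma realize : exists A : policy R E X, forall x s,
  (forall S, fine (seed_law A [set u | accepted x s u = S]) = P (hist x s) S) /\
  (forall u : seed A, accepted x s u = set0 \/ P (hist x s) (accepted x s u) != 0).
Proof.
pose A := Policy (mrestr (@lebesgue_measure R) (measurable_itv `[0, 1[%R))
   measurable_interval_accept.
exists A => x s.
have hu : uniq (unzip1 (hist x s)) by rewrite unzip1_hist arrival_uniq.
have gu : uniq (unzip1 (rev (hist x s))) by rewrite /unzip1 map_rev rev_uniq.
have gS S : S \subset [set e in unzip1 (rev (hist x s))].
  apply/subsetP => e _; rewrite inE /unzip1 map_rev mem_rev.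
  by rewrite -/(unzip1 (hist x s)) unzip1_hist mem_arrival.
have accE (u : seed A) : accepted x s u =
    if u < 1 then state u (rev (hist x s)) else set0.
  by rewrite accepted_acc interval_accE.
split=> [S|u].
  have P0 := behaviour_ge0 PB (hist x s) S.
  set l := left_end (rev (hist x s)) S.
  have l0 : 0 <= l := left_end_ge0 _ _.
  have -> : (seed_law A [set u | accepted x s u = S]) =
     lebesgue_measure ([set` `[l, l + P (hist x s) S[%R ] `&` [set` `[0, 1[%R ] : set mR).
    rewrite /= /mrestr; congr (lebesgue_measure _).
    apply/seteqP; split => u /= [].
      move=> + u01; have := u01; rewrite in_itv /= accE => u01'.
      have /andP[_ ->] := u01'; move=> /eqP.
      rewrite stateE // revK => h; split=> //.
      by rewrite andbT; case/andP: u01'.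
    move=> h u01; split=> //; rewrite accE.
    move: u01; rewrite in_itv /= => u01; have /andP[_ ->] := u01.
    by apply/eqP; rewrite stateE // revK.
  have le1 : l + P (hist x s) S <= 1.
    by have := right_end_le1 gu (gS S); rewrite revK.
  rewrite (_ : _ `&` _ = [set` `[l, l + P (hist x s) S[%R ]); last first.
    apply/seteqP; split => u /= ; first by case.
    rewrite !in_itv /= => /andP[lu ul]; split; first by rewrite lu.
    by rewrite (le_trans l0 lu) (lt_le_trans ul le1).
  rewrite lebesgue_measure_itv /= lte_fin ltrDl lt_neqAle P0 andbT eq_sym.
  by case: eqP => [->//|_] /=; rewrite addrAC subrr add0r.
rewrite accE; case: ifPn => u1; last by left.
have [u0|u0] := ltP u 0; first by left; exact: state_neg.
right; apply/eqP => P0.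
have : state u (rev (hist x s)) == state u (rev (hist x s)) by [].
by rewrite stateE ?u0 ?u1 // revK P0 addr0 leNgt andNb.
Qed.
End Realize.

Section Mixture.
Variables (R : realType) (E F : finType) (X : Type).
Variables (p : F -> R) (d : F -> seq (E * X) -> bool).
Hypotheses (p_ge0 : forall f, 0 <= p f) (p_sum1 : \sum_f p f = 1).

(** A mixed strategy, viewed as a behaviour so that [realize] can turn it into a policy. *)
Definition mixture (h : seq (E * X)) (S : {set E}) : R :=
  \sum_f p f * (acc (d f) h == S)%:R.

Lemma mixture_behaviour : behaviour mixture.
Proof.
split.
- by move=> h S; apply: sumr_ge0 => f _; rewrite mulr_ge0.
- rewrite -p_sum1; apply: eq_bigr => f _.
  by rewrite acc_nil eqxx mulr1.
move=> h q S qh Sh; rewrite /mixture -big_split /=; apply: eq_bigr => f _.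
rewrite -mulrDr -natrD; congr (_ * _%:R).
have qA : q.1 \notin acc (d f) h.
  by apply/negP => /(subsetP (acc_sub _ _)); rewrite inE (negPf qh).
have qS : q.1 \notin S by apply/negP => /(subsetP Sh); rewrite inE (negPf qh).
rewrite acc_rcons //; case: ifP => _.
  rewrite (_ : (_ == S) = false); last first.
    by apply/negbTE; apply: contraNneq qS => <-; rewrite setU11.
  rewrite add0n; congr nat_of_bool; apply/eqP/eqP => [|-> //].
  by move=> /(congr1 (fun B => B :\ q.1)); rewrite !setU1K.
rewrite (_ : (_ == q.1 |: S) = false) ?addn0 //.
by apply/negbTE; apply: contraNneq qA => ->; rewrite setU11.
Qed.

Lemma mixture_sum (h : seq (E * X)) (g : {set E} -> R) :
  \sum_S mixture h S * g S = \sum_f p f * g (acc (d f) h).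
Proof.
under eq_bigr do rewrite mulr_suml.
rewrite exchange_big /=; apply: eq_bigr => f _.
rewrite (bigD1 (acc (d f) h)) //= eqxx mulr1 big1 ?addr0 // => S SQ.
by rewrite eq_sym (negPf SQ) mulr0 mul0r.
Qed.

Lemma mixture_neq0 h S : mixture h S != 0 ->
  exists f, p f != 0 /\ acc (d f) h = S.
Proof.
move=> nz; have /existsP[f] : [exists f, p f * (acc (d f) h == S)%:R != 0].
  apply: contraNT nz; rewrite negb_exists => /forallP nz.
  by apply/eqP; apply: big1 => f _; have := nz f; rewrite negbK => /eqP.
rewrite mulf_eq0 negb_or => /andP[pf].
by case: (acc (d f) h =P S) => [<- _|_]; [exists f|rewrite eqxx].
Qed.

End Mixture.

Section Guard.
Variables (E : finType) (X : Type) (M : matroid E) (d : seq (E * X) -> bool).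
Implicit Types h : seq (E * X).

(** Testing the unguarded set is enough: once it is dependent it stays so, and everything is
    rejected from then on. *)
Definition guard h := d h && (acc d h \in indep M).

Lemma guardP h : uniq (unzip1 h) ->
  acc guard h \in indep M /\ (acc d h \in indep M -> acc guard h = acc d h).
Proof.
elim/last_ind: h => [|h p IH]; first by rewrite !acc_nil indep0.
rewrite {1}/unzip1 map_rcons rcons_uniq => /andP[ph /IH[gM gE]].
rewrite (acc_rcons guard) // (acc_rcons d) // /guard acc_rcons //.
case: (d (rcons h p)) => //=; case: ifP => // dM.
by rewrite gE //; apply: indep_hereditary dM; exact: subsetUr.
Qed.

End Guard.

(** * Finite outcome tables and derandomization *)

Section FiniteValued.
Local Open Scope classical_set_scope.
Variables (R : realType) (disp : measure_display) (U : measurableType disp).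
Variables (mu : probability U R) (T : finType) (f : U -> T).
Hypothesis mf : forall t, measurable [set u | f u = t].

Lemma fine_measure_ge0 (A : set U) : measurable A -> 0 <= fine (mu A).
Proof. by move=> mA; rewrite fine_ge0 // measure_ge0. Qed.

Lemma measurable_pred (Q : pred T) : measurable [set u | Q (f u)].
Proof.
have -> : [set u | Q (f u)] =
    classical_sets.bigcup [set t | Q t] (fun t => [set u | f u = t]).
  by apply/seteqP; split => u /=; [exists (f u)|case=> t /= Qt ->].
by apply: fin_bigcup_measurable => [|t _]; [exact: finite_finset|exact: mf].
Qed.

Lemma prob_pred (Q : pred T) :
  fine (mu [set u | Q (f u)]) = \sum_(t | Q t) fine (mu [set u | f u = t]).
Proof.
rewrite -big_filter.
have : uniq [seq t <- index_enum T | Q t] by rewrite filter_uniq // index_enum_uniq.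
have -> : [set u | Q (f u)] = [set u | f u \in [seq t <- index_enum T | Q t]].
  by apply/seteqP; split => u /=; rewrite mem_filter mem_index_enum andbT.
elim: [seq t <- _ | _] => [_|t s IH /= /andP[ts us]].
  rewrite big_nil (_ : [set _ | _] = classical_sets.set0) ?measure0 //.
  by apply/seteqP; split.
rewrite big_cons -IH // -fineD; first last.
- by rewrite fin_num_measure //; exact: (measurable_pred (mem s)).
- by rewrite fin_num_measure.
congr fine; rewrite -measureU //; first last.
- apply/seteqP; split => u //= [ut us']; move: us'; rewrite ut => h.
  by rewrite h in ts.
- exact: (measurable_pred (mem s)).
congr (mu _); apply/seteqP; split => u /=; rewrite inE.
  by case/orP => [/eqP|]; [left|right].
by case=> [->|->]; rewrite ?eqxx ?orbT.
Qed.

Lemma prob_sum1 : \sum_t fine (mu [set u | f u = t]) = 1.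
Proof.
have := prob_pred xpredT; rewrite (_ : [set _ | _] = classical_sets.setT).
  by rewrite probability_setT => <-.
by apply/seteqP; split.
Qed.

End FiniteValued.

Section Derandomize.
Local Open Scope classical_set_scope.
Variables (R : realType) (E J : finType) (X : Type) (A : policy R E X).
Variables (x : J -> E -> X) (s : J -> {perm E}).

Definition outcomes (u : seed A) : {ffun J -> {set E}} :=
  [ffun j => accepted (x j) (s j) u].

Lemma measurable_outcomes F : measurable [set u | outcomes u = F].
Proof.
pose h e j := [seq (a, x j a) | a <- take (index e (arrival_order (s j))).+1
  (arrival_order (s j))].
have -> : [set u | outcomes u = F] = classical_sets.bigcap classical_sets.setT
   (fun q : J * E => [set u | accept u (h q.2 q.1) = (q.2 \in F q.1)]).
  apply/seteqP; split => u /=.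
    by move=> <- [j e] _ /=; rewrite ffunE inE.
  move=> H; apply/ffunP => j; rewrite ffunE; apply/setP => e.
  by rewrite inE; exact: (H (j, e)).
apply: fin_bigcap_measurable => [|[j e] _ /=]; first exact: finite_finset.
case: (e \in F j).
  exact: measurable_accept.
rewrite (_ : [set _ | _] = ~` [set u | accept u (h e j)]).
  by apply: measurableC; exact: measurable_accept.
by apply/seteqP; split => u /=; [move=> -> //|move/negP/negbTE].
Qed.

Definition outcome_prob F := fine (seed_law A [set u | outcomes u = F]).

Lemma prob_accepted j S :
  fine (seed_law A [set u | accepted (x j) (s j) u = S]) =
  \sum_(F : {ffun J -> {set E}} | F j == S) outcome_prob F.
Proof.
rewrite -(prob_pred (seed_law A) measurable_outcomes (fun F => F j == S)).
congr (fine (seed_law A _)); apply/seteqP; split => u /=; rewrite ffunE => /eqP //.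
Qed.

Lemma outcome_expect (g : J -> {set E} -> R) :
  \sum_j \sum_S fine (seed_law A [set u | accepted (x j) (s j) u = S]) * g j S =
  \sum_F outcome_prob F * \sum_j g j (F j).
Proof.
under [RHS]eq_bigr do rewrite mulr_sumr.
rewrite [RHS]exchange_big /=.
apply: eq_bigr => j _.
under eq_bigr do rewrite prob_accepted mulr_suml.
rewrite (exchange_big_dep xpredT) //=; apply: eq_bigr => F _.
by rewrite (big_pred1 (F j)) // => S; rewrite eq_sym.
Qed.

(** The expectation is an average over finitely many outcome tables. Some table of nonzero
    probability reaches the average, and its event, being nonempty, contains a seed. *)
Lemma derandomize (g : J -> {set E} -> R) v :
  v <= \sum_j \sum_S
         fine (seed_law A [set u | accepted (x j) (s j) u = S]) * g j S ->
  exists u : seed A, v <= \sum_j g j (accepted (x j) (s j) u).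
Proof.
rewrite outcome_expect => vle.
have p1 : \sum_F outcome_prob F = 1 := prob_sum1 (seed_law A) measurable_outcomes.
have p0 F : 0 <= outcome_prob F by apply: fine_measure_ge0; exact: measurable_outcomes.
have /existsP[F /andP[Fp Fv]] :
    [exists F, (outcome_prob F != 0) && (v <= \sum_j g j (F j))].
  apply: contraT; rewrite negb_exists => /forallP H.
  have /existsP[F0 F0p] : [exists F, outcome_prob F != 0].
    apply: contraT; rewrite negb_exists => /forallP H0.
    have := oner_neq0 R; rewrite -p1 big1 ?eqxx // => F _.
    by have := H0 F; rewrite negbK => /eqP.
  have lt F : outcome_prob F != 0 -> \sum_j g j (F j) < v.
    by move=> nz; have := H F; rewrite nz /= -ltNge.
  suff : \sum_F outcome_prob F * \sum_j g j (F j) < v by rewrite ltNge vle.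
  rewrite -[v in _ < v]mul1r -p1 mulr_suml -subr_gt0 -sumrB.
  rewrite (bigD1 F0) //= ltr_pwDl //.
    by rewrite -mulrBr mulr_gt0 ?subr_gt0 ?lt // lt0r F0p p0.
  apply: sumr_ge0 => F _; rewrite -mulrBr.
  have [->|nz] := eqVneq (outcome_prob F) 0; first by rewrite mul0r.
  by rewrite mulr_ge0 // subr_ge0 ltW // lt.
have [u uF] : exists u, outcomes u = F.
  apply: contrapT => nu; move/eqP: Fp; apply; rewrite /outcome_prob.
  rewrite (_ : [set _ | _] = classical_sets.set0) ?measure0 //.
  by apply/seteqP; split => u //= uF; apply: nu; exists u.
exists u; apply: le_trans Fv _; rewrite -uF.
by under eq_bigr do rewrite ffunE.
Qed.

End Derandomize.

(** * Compactness of behaviours *)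

Section Limit.
Import numFieldNormedType.Exports.
Local Open Scope classical_set_scope.

Lemma ultra_cvg (R : realType) (T : Type) (G : set_system T) (f : T -> R) :
  UltraFilter G -> (forall t, 0 <= f t <= 1) -> exists y : R, f @ G --> y.
Proof.
move=> GU f01.
have Gf : (f @ G) `[0, 1]%classic.
  by rewrite /= /fmap; apply: filterE => t /=; rewrite in_itv /= f01.
have [y [_ cly]] := @segment_compact R 0 1 (f @ G) _ Gf.
exists y => B yB.
have [//|nB] := in_ultra_setVsetC (f @^-1` B) GU.
by have [z [/=]] := cly (~` B) B nB yB.
Qed.

(** Behaviours bounded by 1 live in a product of unit intervals, and each constraint involves
    finitely many coordinates, so it passes to limits. Along an ultrafilter containing all sets
    [B l], the constraint of any given [t] eventually holds. *)
Lemma behaviour_limit (R : realType) (E J : finType) (X : Type) (T : eqType)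
    (Z : seq (E * X) -> pred {set E}) (h : T -> J -> seq (E * X))
    (g : T -> J -> {set E} -> R)
    (b : T -> R) :
  (forall l : seq T, exists P, [/\ behaviour P, forall h' S, P h' S <= 1,
     forall h' S, ~~ Z h' S -> P h' S = 0 &
     forall t, t \in l -> b t <= \sum_j \sum_S P (h t j) S * g t j S]) ->
  exists P, [/\ behaviour P, forall h' S, ~~ Z h' S -> P h' S = 0 &
     forall t, b t <= \sum_j \sum_S P (h t j) S * g t j S].
Proof.
move=> /choice[P /all_and4[PB P1 PZ Pb]].
pose B (l : seq T) := [set l' : seq T | {subset l <= l'}].
have FF : Filter (filter_from classical_sets.setT B).
  apply: filter_from_filter; first by exists [::].
  move=> l1 l2 _ _; exists (l1 ++ l2) => // l' s.
  by split=> t tl; apply: s; rewrite mem_cat tl ?orbT.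
have FP : ProperFilter (filter_from classical_sets.setT B).
  by apply: filter_from_proper => l _; exists l.
have [G [GU FG]] := ultraFilterLemma FP.
have /choice[Q Qcvg] : forall hS : seq (E * X) * {set E}, exists y : R,
    (fun l => P l hS.1 hS.2) @ G --> y.
  by move=> hS; apply: ultra_cvg => l; rewrite (behaviour_ge0 (PB l)) P1.
have Qc h' S : (fun l => P l h' S) @ G --> Q (h', S) := Qcvg (h', S).
have Qcst h' S (c : R) : (forall l, P l h' S = c) -> Q (h', S) = c.
  move=> Pc; have := Qc h' S.
  rewrite (_ : (fun l => P l h' S) = fun=> c); last exact/funext.
  move=> cvc; exact: (norm_cvg_unique cvc (cvg_cst c)).
exists (fun h' S => Q (h', S)); split.
- split.
  + move=> h' S; apply: cvgr_to_ge (Qc h' S) _.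
    by apply: filterE => l; exact: behaviour_ge0 (PB l) _ _.
  + by apply: Qcst => l; exact: behaviour_nil (PB l).
  + move=> h' p S ph Sh.
    have cD := cvgD (Qc (rcons h' p) S) (Qc (rcons h' p) (p.1 |: S)).
    apply: (norm_cvg_unique _ (Qc h' S)).
    have -> : (fun l => P l h' S) =
        (fun l => P l (rcons h' p) S + P l (rcons h' p) (p.1 |: S)).
      by apply/funext => l; rewrite (behaviour_rcons (PB l) ph Sh).
    exact: cD.
- by move=> h' S nZ; apply: Qcst => l; exact: PZ.
- move=> t.
  apply: (cvgr_to_ge (F := G) (f := fun l => \sum_j \sum_S P l (h t j) S * g t j S)).
    apply: cvg_big => [|j _]; first exact: add_continuous.
    apply: cvg_big => [|S _]; first exact: add_continuous.
    by apply: cvgM; [exact: Qc|exact: cvg_cst].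
  apply: FG; exists [:: t] => // l /= tl; apply: Pb; apply: tl.
  by rewrite inE.
Qed.

End Limit.

(** * From secretary algorithms to contention resolution *)

Section RandomOrderContention.
Variables (R : realType) (E : finType) (M : matroid E).
Implicit Types (Q S : {set E}) (s : {perm E}).

Let nperm : R := #|{perm E}|%:R.

Lemma nperm_gt0 : 0 < nperm.
Proof. by rewrite /nperm ltr0n; apply/card_gt0P; exists (perm_one E). Qed.

Definition crm_valid (d : seq (E * bool) -> bool) : Prop :=
  forall Q s, let S := acc d (hist (fun e => e \in Q) s) in
    (S \subset Q) && (S \in indep M).

(** Minimax over deterministic online rules, coded by their outcomes on all pairs of an active set
    and an order; the optimal mixture is realised as a policy. The factor [nperm] turns averages
    over orders into sums. *)
Lemma ro_crm_minimax (rho : fdist R {set E}) (target : E -> R) :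
  (forall y : E -> R, (forall i, 0 <= y i) -> exists d, crm_valid d /\
     nperm * (\sum_i y i * target i) <=
     \sum_Q rho Q * \sum_s weight y (acc d (hist (fun e => e \in Q) s))) ->
  exists phi : crm R M, ro_crm phi /\
    forall i, target i <= \sum_Q rho Q * \sum_(S : {set E} | i \in S) phi Q S.
Proof.
move=> H.
pose F := {ffun {set E} * {perm E} -> {set E}}.
pose code (d : {d | crm_valid d}) : F :=
  [ffun j : {set E} * {perm E} => acc (sval d) (hist (fun e => e \in j.1) j.2)].
pose hit (f : F) i : R := \sum_Q rho Q * \sum_s (i \in f (Q, s))%:R.
have [y y0|p [p0 p1 pD pa]] :=
    @minimax_code R _ F E code (fun f i => hit f i - nperm * target i).
  have [d [dV dy]] := H y y0; exists (exist _ d dV).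
  under eq_bigr do rewrite mulrBr.
  rewrite sumrB subr_ge0.
  have -> : \sum_i y i * (nperm * target i) = nperm * \sum_i y i * target i.
    by rewrite mulr_sumr; apply: eq_bigr => i _; rewrite mulrCA.
  apply: le_trans dy _; rewrite le_eqVlt; apply/orP; left; apply/eqP.
  under [RHS]eq_bigr do rewrite mulr_sumr.
  rewrite [RHS]exchange_big /=; apply: eq_bigr => Q _.
  under [RHS]eq_bigr do rewrite mulrCA mulr_sumr.
  rewrite -mulr_sumr exchange_big /=; congr (_ * _); apply: eq_bigr => s _.
  by rewrite weightE; apply: eq_bigr => i _; rewrite ffunE.
(* The rule that rejects everything represents the codes of probability zero. *)
have d0V : crm_valid (fun=> false).
  move=> Q s /=; rewrite (_ : acc _ _ = set0) ?sub0set ?indep0 //.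
  by apply/setP => e; rewrite !inE andbF.
have /choice[rep repP] : forall f : F, exists d : {d | crm_valid d},
    p f != 0 -> code d = f.
  move=> f; have [pf|pf] := eqVneq (p f) 0; first by exists (exist _ _ d0V).
  by have [d cd] := pD f pf; exists d.
have [A AP] := realize (mixture_behaviour (fun f => sval (rep f)) p0 p1).
pose x Q := (fun e => e \in Q).
have lawE Q S : output_law A (x Q) S =
    (\sum_s mixture p (fun f => sval (rep f)) (hist (x Q) s) S) / nperm.
  by congr (_ / _); apply: eq_bigr => s _; have [-> _] := AP (x Q) s.
have law0 Q S : 0 <= output_law A (x Q) S.
  rewrite lawE divr_ge0 ?(ltW nperm_gt0) //; apply: sumr_ge0 => s _.
  exact: behaviour_ge0 (mixture_behaviour _ p0 p1) _ _.
have lawg Q (g : {set E} -> R) : \sum_S output_law A (x Q) S * g S =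
    (\sum_s \sum_f p f * g (f (Q, s))) / nperm.
  under eq_bigr do rewrite lawE mulrAC mulr_suml.
  rewrite -mulr_suml exchange_big; congr (_ / _); apply: eq_bigr => s _ /=.
  rewrite mixture_sum; apply: eq_bigr => f _.
  have [->|pf] := eqVneq (p f) 0; first by rewrite !mul0r.
  by have /ffunP/(_ (Q, s)) := repP f pf; rewrite ffunE => <-.
have law1 Q : \sum_S output_law A (x Q) S = 1.
  have := lawg Q (fun=> 1); rewrite -mulr_suml mulr1 => ->.
  under eq_bigr do rewrite -mulr_suml p1 mulr1.
  by rewrite sumr_const divff //; apply: lt0r_neq0; exact: nperm_gt0.
pose phi0 Q := Fdist (law0 Q) (law1 Q).
have mixV Q s S : mixture p (fun f => sval (rep f)) (hist (x Q) s) S != 0 ->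
    (S \subset Q) && (S \in indep M).
  by case/mixture_neq0 => f [_ <-]; exact: (svalP (rep f)).
have sup Q S : phi0 Q S != 0 -> (S \subset Q) && (S \in indep M).
  rewrite /= lawE mulf_eq0 negb_or => /andP[nz _].
  have /existsP[s /mixV //] : [exists s,
      mixture p (fun f => sval (rep f)) (hist (x Q) s) S != 0].
  apply: contraNT nz; rewrite negb_exists => /forallP nz.
  by apply/eqP; apply: big1 => s _; have := nz s; rewrite negbK => /eqP.
exists (Crm sup); split.
  exists A; split=> // Q s u /=.
  have [_ /(_ u)] := AP (x Q) s; rewrite -/(x Q).
  by case=> [->|/mixV //]; rewrite sub0set indep0.
move=> i; rewrite -subr_ge0 -(pmulr_rge0 _ nperm_gt0) mulrBr.
have := pa i; under eq_bigr do rewrite mulrBr.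
rewrite sumrB -mulr_suml p1 mul1r; congr (0 <= _ - _).
rewrite /hit mulr_sumr; under eq_bigr do rewrite mulr_sumr.
rewrite exchange_big /=; apply: eq_bigr => Q _.
rewrite [in RHS](sum_indic (fun S : {set E} => i \in S)) /=.
rewrite (lawg Q (fun S => (i \in S)%:R)) [RHS]mulrCA [nperm * _]mulrC.
rewrite divfK ?gt_eqF ?nperm_gt0 // exchange_big mulr_sumr.
apply: eq_bigr => f _; rewrite mulrCA; congr (_ * _).
by rewrite mulr_sumr.
Qed.

(** Add up the balance inequalities with weights [y]: what is selected from [Q] is independent and
    inside [Q], so its weight is at most the rank of [y] restricted to [Q]. *)
Lemma uncontentious_rank (alpha : R) (rho : fdist R {set E}) (y : E -> R) :
  (forall i, 0 <= y i) -> uncontentious M alpha rho ->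
  alpha * (\sum_Q rho Q * weight y Q) <=
    \sum_Q rho Q * rank M (fun i => y i * (i \in Q)%:R).
Proof.
move=> y0 [phi phiB].
have -> : \sum_Q rho Q * weight y Q =
    \sum_i y i * \sum_(Q : {set E} | i \in Q) rho Q.
  under eq_bigr do rewrite weightE mulr_sumr.
  rewrite exchange_big; apply: eq_bigr => i _.
  rewrite [\sum_(Q : {set E} | i \in Q) _]sum_indic mulr_sumr.
  by apply: eq_bigr => Q _; rewrite mulrCA.
rewrite mulr_sumr.
apply: (@le_trans _ _ (\sum_i y i * \sum_Q rho Q * \sum_(S : {set E} | i \in S) phi Q S)).
  by apply: ler_sum => i _; rewrite mulrCA ler_wpM2l.
under eq_bigr do rewrite mulr_sumr.
rewrite exchange_big; apply: ler_sum => Q _ /=.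
under eq_bigr do rewrite mulrCA.
rewrite -mulr_sumr ler_wpM2l ?fdist_ge0 //.
under eq_bigr do rewrite sum_indic mulr_sumr.
rewrite exchange_big /=.
rewrite -[leRHS]mul1r -[X in X * rank _ _](fdist_sum1 (phi Q)) mulr_suml.
apply: ler_sum => S _; under eq_bigr do rewrite mulrCA.
rewrite -mulr_sumr; have [->|nz] := eqVneq (phi Q S) 0; first by rewrite !mul0r.
have /andP[SQ SM] := crm_support nz.
rewrite ler_wpM2l ?fdist_ge0 //; apply: le_trans (weight_le_rank _ SM).
rewrite weightE le_eqVlt; apply/orP; left; apply/eqP; apply: eq_bigr => i _.
by have [/(subsetP SQ) ->|] := boolP (i \in S); rewrite ?mulr1 ?mulr0.
Qed.

(** For given [y], fix a good seed, feed the algorithm [y] on active elements and 0 elsewhere, and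
    discard accepted inactive elements, which weigh nothing. The hypothesis is a rank inequality
    because this form passes to a supremum of values [a]. *)
Lemma secretary_ro_crm (c : R) (A : secretary_algorithm R M)
    (rho : fdist R {set E}) (a : R) : 0 <= c -> competitive c A ->
  (forall y : E -> R, (forall i, 0 <= y i) ->
    a * (\sum_Q rho Q * weight y Q) <=
    \sum_Q rho Q * rank M (fun i => y i * (i \in Q)%:R)) ->
  exists phi : crm R M, ro_crm phi /\ balanced (c * a) phi rho.
Proof.
move=> c0 cA Ha; apply: ro_crm_minimax => y y0.
pose w Q i := y i * (i \in Q)%:R.
have w0 Q i : 0 <= w Q i by rewrite mulr_ge0.
pose wb (b : E * bool) := (b.1, if b.2 then y b.1 else 0).
have wbE Q i : wb (i, i \in Q) = (i, w Q i).
  by rewrite /wb /w /=; case: (i \in Q); rewrite ?mulr1 ?mulr0.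
pose x (j : {set E} * {perm E}) := w j.1.
have [u vle] : exists u : seed A,
   nperm * (\sum_i y i * (c * a * (\sum_(Q : {set E} | i \in Q) rho Q))) <=
   \sum_(j : {set E} * {perm E}) rho j.1 * weight (w j.1) (accepted (w j.1) j.2 u).
  apply: (@derandomize R E _ _ A x (fun j => j.2)
    (fun j S => rho j.1 * weight (w j.1) S)).
  have -> : \sum_i y i * (c * a * (\sum_(Q : {set E} | i \in Q) rho Q)) =
      c * (a * \sum_Q rho Q * weight y Q).
    rewrite mulrA mulr_sumr.
    under [RHS]eq_bigr do rewrite weightE mulr_sumr mulr_sumr.
    rewrite exchange_big; apply: eq_bigr => i _ /=.
    by rewrite sum_indic !mulr_sumr; apply: eq_bigr => Q _; ring.
  apply: (@le_trans _ _ (nperm * (c * \sum_Q rho Q * rank M (w Q)))).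
    by rewrite ler_wpM2l ?(ltW nperm_gt0) // ler_wpM2l // Ha.
  rewrite mulr_sumr mulr_sumr -(pair_big xpredT xpredT (fun Q s =>
     \sum_S fine (seed_law A [set u | accepted (w Q) s u = S]%classic) *
       (rho Q * weight (w Q) S))) /=.
  apply: ler_sum => Q _.
  have lawE : \sum_S output_law A (w Q) S * weight (w Q) S = (\sum_s \sum_S
      fine (seed_law A [set u | accepted (w Q) s u = S]%classic) *
        weight (w Q) S) / nperm.
    rewrite exchange_big mulr_suml; apply: eq_bigr => S _.
    by rewrite /output_law mulrAC mulr_suml.
  have := cA (w Q) (w0 Q); rewrite lawE ler_pdivlMr ?nperm_gt0 // => h.
  have := ler_wpM2l (fdist_ge0 rho Q) h; congr (_ <= _); first by ring.
  rewrite mulr_sumr; apply: eq_bigr => s _; rewrite mulr_sumr.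
  by apply: eq_bigr => S _; rewrite mulrCA.
pose d (h : seq (E * bool)) : bool :=
  (if rev h is b :: _ then b.2 else false) && accept u [seq wb b | b <- h].
have dE Q s : acc d (hist (fun e => e \in Q) s) = Q :&: accepted (w Q) s u.
  apply/setP => e; rewrite mem_acc_hist in_setI inE /d.
  set o := arrival_order s; set k := index e o.
  have ko : (k < size o)%N by rewrite index_mem mem_arrival.
  congr andb.
    rewrite -map_rev (take_nth e) // rev_rcons /=.
    by rewrite nth_index // mem_arrival.
  rewrite -map_comp; congr (accept u _); apply: eq_map => b /=.
  exact: wbE.
exists d; split.
  move=> Q s /=; rewrite dE subsetIl; apply: indep_hereditary (subsetIr _ _) _.
  exact: secretary_indep.
apply: le_trans vle _.
rewrite -(pair_big xpredT xpredT (fun Q s =>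
  rho Q * weight (w Q) (accepted (w Q) s u))) /=.
apply: ler_sum => Q _; rewrite -mulr_sumr ler_wpM2l ?fdist_ge0 //.
apply: ler_sum => s _; rewrite dE !weightE le_eqVlt; apply/orP; left; apply/eqP.
apply: eq_bigr => i _; rewrite /w in_setI.
by case: (i \in Q); rewrite ?mulr1 ?mulr0 ?mul0r.
Qed.

(** To serve all [alpha] with one scheme, aim for the supremum of those for which the prior is
    uncontentious. The rank inequality holds there, and balance at the supremum implies balance
    below it. *)
Lemma universal_secretary (c : R) (A : secretary_algorithm R M) :
  0 <= c -> competitive c A ->
  exists phi : crs R M, ro_crs phi /\
    forall alpha : R, 0 <= alpha <= 1 -> universal (c * alpha) alpha phi.
Proof.
move=> c0 cA.
have /choice[phi phiP] : forall rho : fdist R {set E}, exists phi : crm R M,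
    ro_crm phi /\ forall alpha : R, 0 <= alpha <= 1 ->
      uncontentious M alpha rho -> balanced (c * alpha) phi rho.
  move=> rho.
  pose good : set R := [set alpha | 0 <= alpha <= 1 /\ uncontentious M alpha rho]%classic.
  have [[a0 ga0]|ng] := pselect (classical_sets.nonempty good); last first.
    have [y y0|phi [phiR _]] := @secretary_ro_crm c A rho 0 c0 cA.
      rewrite mul0r; apply: sumr_ge0 => Q _.
      by rewrite mulr_ge0 ?fdist_ge0 // rank_ge0.
    by exists phi; split=> // al al1 alU; case: ng; exists al.
  have hs : has_sup good.
    by split; [exists a0|exists 1 => al [/andP[]]].
  have [y y0|phi [phiR phiB]] := @secretary_ro_crm c A rho (sup good) c0 cA.
    set v := \sum_Q rho Q * weight y Q; set r := (X in _ <= X).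
    have v0 : 0 <= v.
      by apply: sumr_ge0 => Q _; rewrite mulr_ge0 ?fdist_ge0 // sumr_ge0.
    have r0 : 0 <= r.
      by apply: sumr_ge0 => Q _; rewrite mulr_ge0 ?fdist_ge0 // rank_ge0.
    have [v1|v1] := eqVneq v 0; first by rewrite v1 mulr0.
    have vp : 0 < v by rewrite lt0r v1.
    rewrite -ler_pdivlMr //; apply: ge_sup; first by exists a0.
    move=> al [_ alU]; rewrite ler_pdivlMr //.
    exact: uncontentious_rank.
  exists phi; split=> // al al1 alU i.
  apply: le_trans (phiB i); rewrite ler_wpM2r //.
    by apply: sumr_ge0 => Q _; exact: fdist_ge0.
  by rewrite ler_wpM2l //; apply: ub_le_sup => //; case: hs.
exists phi; split=> [rho|alpha al1 rho alU]; first by case: (phiP rho).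
by have [_] := phiP rho; apply.
Qed.

End RandomOrderContention.

(** * Improving elements of a random sample *)

Section Coordinate.
Variables (R : realType) (E T : finType).
Implicit Types (q : {ffun E -> T}) (e : E).

Definition agree_off e q q' := forall x, x != e -> q x = q' x.

Definition upd q e a : {ffun E -> T} := [ffun x => if x == e then a else q x].

(* The pair [(q, a)] is exchanged with [(upd q e a, q e)]. *)
Lemma sum_coord e (G : {ffun E -> T} -> T -> R) :
  (forall q q' a, agree_off e q q' -> G q a = G q' a) ->
  \sum_q \sum_a G q a = #|T|%:R * \sum_q G q (q e).
Proof.
move=> HG; rewrite pair_big /=.
pose f (z : {ffun E -> T} * T) := (upd z.1 e z.2, z.1 e).
have fK : involutive f.
  case=> q a; rewrite /f /=; congr pair; last by rewrite ffunE eqxx.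
  by apply/ffunP => x; rewrite !ffunE; case: eqP => // ->.
rewrite (reindex_inj (inv_inj fK)) /=.
rewrite (eq_bigr (fun z : {ffun E -> T} * T => G z.1 (z.1 e))); last first.
  by case=> q a _ /=; apply: HG => x xe; rewrite ffunE (negPf xe).
rewrite -(pair_big xpredT xpredT (fun q (_ : T) => G q (q e))) /= mulr_sumr.
by apply: eq_bigr => q _; rewrite sumr_const mulr_natl cardT.
Qed.

(** Resample coordinate [e'], then coordinate [e]. *)
Lemma sum_coord2 e e' (G : T -> T -> R) : e != e' ->
  #|T|%:R ^+ 2 * (\sum_(q : {ffun E -> T}) G (q e) (q e')) =
  #|{ffun E -> T}|%:R * \sum_a \sum_b G a b.
Proof.
move=> ee'; rewrite expr2 -mulrA.
rewrite -(@sum_coord e' (fun (q : {ffun E -> T}) b => G (q e) b)); last first.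
  by move=> q q' b H; rewrite H.
rewrite -(@sum_coord e (fun (q : {ffun E -> T}) a => \sum_b G a b)) //.
by rewrite sumr_const mulr_natl cardT.
Qed.

End Coordinate.

Section Sampling.
Variables (R : realType) (E : finType) (M : matroid E) (m : nat).
Implicit Types (q : {ffun E -> 'I_m.+1}).

(** For uniform [q], an element is sampled with probability [m / (m + 1)]; the value [ord_max] marks
    the late elements. *)
Definition sampled q : {set E} := [set e | q e != ord_max].

(** Membership of [e] in [D q] is independent of [q e], so a member is late with probability
    [1 / (m + 1)]. *)
Lemma late_sum (D : {ffun E -> 'I_m.+1} -> {set E}) (w : E -> R) :
  (forall e q q', agree_off e q q' -> (e \in D q) = (e \in D q')) ->
  m.+1%:R * \sum_q weight w (D q :\: sampled q) = \sum_q weight w (D q).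
Proof.
move=> HD; rewrite mulr_sumr.
under eq_bigr do rewrite weightE mulr_sumr.
under [RHS]eq_bigr do rewrite weightE.
rewrite exchange_big [RHS]exchange_big /=; apply: eq_bigr => e _.
rewrite -mulr_sumr.
have := @sum_coord R E 'I_m.+1 e
  (fun q c => w e * ((e \in D q) && (c == ord_max))%:R).
rewrite card_ord => H; rewrite [LHS](_ : _ = m.+1%:R *
   \sum_q w e * ((e \in D q) && (q e == ord_max))%:R); last first.
  by congr (_ * _); apply: eq_bigr => q _; rewrite !inE negbK andbC.
rewrite -H; last by move=> q q' a h; rewrite (HD e q q').
apply: eq_bigr => q _; rewrite (bigD1 ord_max) //= eqxx andbT big1 ?addr0 //.
by move=> c /negPf ->; rewrite andbF mulr0.
Qed.

Lemma weight1 (S : {set E}) : weight (fun=> 1) S = #|S|%:R :> R.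
Proof. by rewrite /weight sumr_const. Qed.

Variable o : E -> nat.
Hypothesis o_inj : injective o.

Definition candidates q : {set E} := [set e | ~~ spans M (sampled q :&: before o e) e].
Definition improving q : {set E} := candidates q :\: sampled q.

Lemma candidates_agree e q q' e' : agree_off e q q' -> ~~ (o e < o e')%N ->
  (e' \in candidates q) = (e' \in candidates q').
Proof.
move=> H lt; rewrite !inE; congr (~~ spans _ _ _); apply/setP => x; rewrite !inE.
case ox : (o x < o e')%N; rewrite ?andbF //=; rewrite H //.
by apply: contra lt => /eqP <-.
Qed.

(* Membership of [e] in [candidates q], or in the greedy basis of
   [candidates q :&: T], depends only on the sampling of elements preceding [e],
   hence is independent of the sampling of [e]. *)
Lemma improving_rk (T : {set E}) :
  m%:R * (\sum_q #|improving q :&: T|%:R) <=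
  m.+1%:R * \sum_q (rk M (improving q :&: T))%:R :> R.
Proof.
pose D q := greedy M o (candidates q :&: T).
have DE e q q' : agree_off e q q' -> (e \in D q) = (e \in D q').
  move=> H; rewrite /D /greedy [LHS]in_set [RHS]in_set !in_setI.
  rewrite (candidates_agree H) ?ltnn //.
  congr (_ && ~~ spans _ _ _); apply/setP => x; rewrite !in_setI.
  have [ox|] := boolP (x \in before o e); rewrite ?andbF //; congr (_ && _ && _).
  rewrite inE in ox.
  by apply: candidates_agree H _; rewrite -leqNgt ltnW.
have CE e q q' : agree_off e q q' ->
    (e \in candidates q :&: T) = (e \in candidates q' :&: T).
  by move=> H; rewrite !in_setI (candidates_agree H) ?ltnn.
have cT q : (candidates q :&: T) :\: sampled q = improving q :&: T.
  by apply/setP => x; rewrite !in_setI !in_setD in_setI andbA.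
have := late_sum (fun=> 1) CE; have := late_sum (fun=> 1) DE.
under eq_bigr do rewrite weight1.
under [X in _ = X -> _]eq_bigr do rewrite weight1.
under [X in _ -> _ * X = _ -> _]eq_bigr do rewrite weight1 cT.
under [X in _ -> _ = X -> _]eq_bigr do rewrite weight1.
set iT := \sum_q #|improving q :&: T|%:R.
set cTs := \sum_q #|candidates q :&: T|%:R => Dl Cl.
have le1 : \sum_q #|D q :\: sampled q|%:R <=
    \sum_q (rk M (improving q :&: T))%:R :> R.
  apply: ler_sum => q _; rewrite ler_nat leq_rk //.
    have [DM _] := greedyP M o_inj (candidates q :&: T).
    by apply: indep_hereditary DM; exact: subsetDl.
  by rewrite -cT; apply: setSD; exact: greedy_sub.
(* The sampled candidates lie in the greedy basis of the sample, so those in [T] are independent and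
   at most as many as the rank of [candidates q :&: T]. *)
have le2 : cTs - iT <= \sum_q #|D q|%:R.
  rewrite -sumrB; apply: ler_sum => q _.
  rewrite -[X in X%:R - _](cardsID (sampled q)) cT natrD addrK ler_nat.
  have [_ ->] := greedyP M o_inj (candidates q :&: T).
  rewrite leq_rk ?subsetIl //.
  have [SM _] := greedyP M o_inj (sampled q); apply: indep_hereditary SM.
  apply/subsetP => x; rewrite in_setI => /andP[/setIP[xC _] xS].
  by move: xC; rewrite !in_set => ->; move: xS; rewrite in_set => ->.
(* By [late_sum], [cTs] is [m + 1] times [iT], so [cTs - iT] is [m] times [iT]. *)
apply: le_trans (ler_wpM2l (ler0n _ _) le1); rewrite Dl.
by apply: le_trans le2; rewrite -Cl -natr1 mulrDl mul1r addrK.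
Qed.

End Sampling.

(** The greedy basis consists of candidates whatever the sample, since a smaller set spans less;
    each candidate is late with probability [1 / (m + 1)]. *)
Lemma improving_weight (R : realType) (E : finType) (M : matroid E) (m : nat)
    (w : E -> R) : (forall e, 0 <= w e) ->
  #|{ffun E -> 'I_m.+1}|%:R * rank M w <=
  m.+1%:R * \sum_(q : {ffun E -> 'I_m.+1}) weight w (improving M (worder w) q).
Proof.
move=> w0; rewrite late_sum; last first.
  by move=> e q q' H; rewrite (candidates_agree M H) ?ltnn.
rewrite mulr_natl -sumr_const; apply: ler_sum => q _.
apply: (le_trans (rank_le_greedy M w0)); rewrite !weightE; apply: ler_sum => e _.
rewrite ler_wpM2l // ler_nat; have [|//] := boolP (e \in greedy M _ _).
rewrite in_set in_setT setTI /= => nsp.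
suff -> : e \in candidates M (worder w) q by [].
by rewrite in_set; apply: contra nsp; apply: spansS; exact: subsetIr.
Qed.

(** * Matroids with parallel copies *)

Section Parallel.
Variables (E X : finType) (f : X -> E) (M : matroid E).

(** Here [f] maps a copy to its original; the equality of cardinals forbids two copies of the same
    element. *)
Definition parallel_indep : {set {set X}} :=
  [set A : {set X} | (#|f @: A| == #|A|) && (f @: A \in indep M)].

Lemma parallel_indep0 : set0 \in parallel_indep.
Proof. by rewrite inE imset0 !cards0 eqxx indep0. Qed.

Lemma parallel_hereditary (A B : {set X}) :
  A \subset B -> B \in parallel_indep -> A \in parallel_indep.
Proof.
move=> AB; rewrite !inE => /andP[/imset_injP Bi BM]; apply/andP; split.
  by apply/imset_injP => x y /(subsetP AB) xB /(subsetP AB) yB; exact: Bi.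
by apply: indep_hereditary BM; exact: imsetS.
Qed.

Lemma parallel_exchange (A B : {set X}) :
  A \in parallel_indep -> B \in parallel_indep -> (#|A| < #|B|)%N ->
  exists2 x : X, x \in B :\: A & x |: A \in parallel_indep.
Proof.
rewrite !inE => /andP[/eqP Ac AM] /andP[/eqP Bc BM]; rewrite -Ac -Bc => lt.
have [e] := indep_exchange AM BM lt.
rewrite inE => /andP[eA /imsetP[x xB ex]] eM.
have xA : x \notin A by apply: contra eA => xA; rewrite ex imset_f.
exists x; first by rewrite inE xA.
by rewrite inE imsetU1 -ex eM andbT cardsU1 eA cardsU1 xA Ac.
Qed.

Definition parallel : matroid X :=
  Matroid parallel_indep0 parallel_hereditary parallel_exchange.

Lemma rk_parallel (g : E -> X) (A : {set E}) : cancel g f ->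
  rk parallel (g @: A) = rk M A.
Proof.
move=> gK; have fg (B : {set E}) : f @: (g @: B) = B.
  by rewrite -imset_comp (eq_imset _ gK) imset_id.
apply/eqP; rewrite eqn_leq; apply/andP; split.
  have [B [BM BA <-]] := rk_ex parallel (g @: A).
  move: BM; rewrite inE => /andP[/eqP <- BM]; rewrite leq_rk //.
  by rewrite -[A]fg imsetS.
have [B [BM BA <-]] := rk_ex M A.
rewrite -(card_imset B (can_inj gK)) leq_rk ?imsetS //.
by rewrite inE fg BM card_imset ?eqxx //; exact: can_inj gK.
Qed.

End Parallel.

(** * Random orders of copies *)

Section Positions.
Variables (X : finType) (N : nat).
Implicit Types (s : {perm X}) (x : X).

Definition pos s x : nat := index x (arrival_order s).

Lemma pos_inj s : injective (pos s).
Proof.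
by move=> x y /(congr1 (nth x (arrival_order s))); rewrite !nth_index ?mem_arrival.
Qed.

Lemma pos_tperm s x y z : pos (s * tperm x y)%g z = pos s (tperm x y z).
Proof.
rewrite /pos -{1}(tpermK x y z) /arrival_order.
under eq_map do rewrite permM.
by rewrite map_comp index_map //; exact: perm_inj.
Qed.

Variable k : 'I_N -> X.
Hypothesis k_inj : injective k.

Definition copies_before s x : nat := #|[set c | (pos s (k c) < pos s x)%N]|.

Lemma copies_before_lt s x c :
  (copies_before s (k c) < copies_before s x)%N = (pos s (k c) < pos s x)%N.
Proof.
apply/idP/idP; last first.
  move=> lt; apply: proper_card; apply/properP; split.
    by apply/subsetP => c'; rewrite !inE => /ltn_trans; apply.
  by exists c; rewrite !inE ?ltnn.
apply: contraTT; rewrite -!leqNgt => ge; apply: subset_leq_card.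
by apply/subsetP => c'; rewrite !inE => lt; exact: leq_trans lt ge.
Qed.

Lemma copies_before_ltN s c : (copies_before s (k c) < N)%N.
Proof.
rewrite -[X in (_ < X)%N]card_ord -cardsT; apply: proper_card; apply/properP.
by split; [exact: subsetT|exists c; rewrite !inE ?ltnn].
Qed.

Definition copy_rank s c : 'I_N := Ordinal (copies_before_ltN s c).

Lemma copy_rank_inj s : injective (copy_rank s).
Proof.
move=> c c' /(congr1 val) /= h; apply/k_inj/(@pos_inj s).
have := copies_before_lt s (k c') c; have := copies_before_lt s (k c) c'.
by rewrite h ltnn; case: ltngtP.
Qed.

Definition nth_copy s : {perm 'I_N} := (perm (@copy_rank_inj s))^-1%g.

Lemma nth_copyK s r : copy_rank s (nth_copy s r) = r.
Proof. by rewrite -(permE (@copy_rank_inj s)) permKV. Qed.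

Lemma copy_rankK s c : nth_copy s (copy_rank s c) = c.
Proof. by rewrite -(permE (@copy_rank_inj s)) permK. Qed.

Lemma pos_nth_copy s x (r : 'I_N) :
  (pos s (k (nth_copy s r)) < pos s x)%N = (r < copies_before s x)%N.
Proof. by rewrite -copies_before_lt -{2}(nth_copyK s r). Qed.

End Positions.

Lemma sum_interval (n b0 b : nat) :
  (\sum_(i < n) ((b0 <= i) && (i < b)) = minn n b - b0)%N.
Proof. by elim: n => [|n IH]; rewrite ?big_ord0 ?big_ord_recr /= ?IH; lia. Qed.

Section Inversions.
Variables (R : realType) (X : finType) (N : nat) (kX kY : 'I_N -> X).
Hypotheses (kX_inj : injective kX) (kY_inj : injective kY).
Hypothesis kXY : forall c c', kX c != kY c'.
Implicit Types s : {perm X}.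

Let z c c' s : R :=
  (pos s (kY c') < pos s (kX c))%N%:R - (pos s (kX c') < pos s (kX c))%N%:R.

(* Exchanging the copies of index [c2] negates one factor and fixes the other. *)
Lemma sum_cross (c c1 c2 : 'I_N) : c1 != c2 -> \sum_s z c c1 s * z c c2 s = 0.
Proof.
wlog c2c : c1 c2 / c2 != c => [H|c12].
  move=> c12; have [e|ne] := eqVneq c2 c; last exact: H.
  under eq_bigr do rewrite mulrC.
  by apply: H; [rewrite -e|rewrite eq_sym].
pose t := tperm (kX c2) (kY c2).
have tD x : x != kX c2 -> x != kY c2 -> t x = x.
  by move=> h1 h2; rewrite /t tpermD // eq_sym.
suff h : \sum_s z c c1 s * z c c2 s = - \sum_s z c c1 s * z c c2 s by lra.
rewrite {1}(reindex_inj (mulIg t)) /= -sumrN; apply: eq_bigr => s _.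
have tXc : t (kX c) = kX c by rewrite tD ?kXY // (inj_eq kX_inj) eq_sym.
have tX1 : t (kX c1) = kX c1 by rewrite tD ?kXY // (inj_eq kX_inj).
have tY1 : t (kY c1) = kY c1.
  by rewrite tD ?(inj_eq kY_inj) // eq_sym kXY.
by rewrite /z !pos_tperm -/t tXc tX1 tY1 /t tpermR tpermL; ring.
Qed.

Let D c s : R := (copies_before kY s (kX c))%:R - (copies_before kX s (kX c))%:R.

(** The drift [D c] is a sum of [N] terms in [[-1, 1]], and the cross terms of its square vanish by
    [sum_cross]. *)
Lemma sum_drift_sq c : \sum_s D c s ^+ 2 <= N%:R * #|{perm X}|%:R.
Proof.
have DE s : D c s = \sum_c' z c c' s.
  rewrite /D /copies_before -!sum1_card !natr_sum sumrB !(big_mkcond (fun i => i \in _)).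
  by congr (_ - _); apply: eq_bigr => c' _; rewrite inE; case: ifP.
under eq_bigr do rewrite DE expr2 mulr_suml.
under eq_bigr do under eq_bigr do rewrite mulr_sumr.
rewrite exchange_big /= mulr_natl -[X in _ *+ X]card_ord -sumr_const.
apply: ler_sum => c1 _; rewrite exchange_big (bigD1 c1) //= [X in _ + X]big1 ?addr0.
  rewrite -sumr_const; apply: ler_sum => s _; rewrite /z.
  by do 2 case: (_ < _)%N; rewrite /=; lra.
by move=> c2 c21; rewrite sum_cross // eq_sym.
Qed.

(** For the copy [kX c], the ranks [r'] counted form an interval whose length is at most the
    positive part of the drift [u]. A square [N] avoids roots: [a * u <= u ^ 2 + N], and both terms
    sum to at most [N ^ 2] per order. *)
Lemma inversions_bound (a : nat) : N = (a ^ 2)%N ->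
  a%:R * (\sum_s \sum_(r : 'I_N) \sum_(r' : 'I_N)
     ((r <= r') && (pos s (kY (nth_copy kY_inj s r')) <=
                    pos s (kX (nth_copy kX_inj s r))))%N%:R)
  <= 2 * N%:R ^+ 2 * #|{perm X}|%:R :> R.
Proof.
move=> Na.
have step s : \sum_(r : 'I_N) \sum_(r' : 'I_N)
     ((r <= r') && (pos s (kY (nth_copy kY_inj s r')) <=
                    pos s (kX (nth_copy kX_inj s r))))%N%:R <=
   \sum_c (copies_before kY s (kX c) - copies_before kX s (kX c))%N%:R :> R.
  rewrite (reindex (copy_rank kX s)); last first.
    exists (nth_copy kX_inj s) => c _; first exact: copy_rankK.
    exact: nth_copyK.
  apply: ler_sum => c _; rewrite copy_rankK -natr_sum ler_nat /=.
  set b := copies_before kY s _; set b0 := copies_before kX s _.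
  rewrite (eq_bigr (fun r' : 'I_N => ((b0 <= r') && (r' < b))%N : nat)); last first.
    move=> r' _; rewrite -pos_nth_copy (leq_eqVlt (pos s (kY _))) (inj_eq (@pos_inj _ s)).
    by rewrite [kY _ == _]eq_sym (negPf (kXY _ _)).
  by rewrite sum_interval leq_sub2r // geq_minr.
apply: (@le_trans _ _ (\sum_s \sum_c (D c s ^+ 2 + N%:R))).
  rewrite mulr_sumr; apply: ler_sum => s _.
  apply: le_trans (ler_wpM2l (ler0n _ _) (step s)) _.
  rewrite mulr_sumr; apply: ler_sum => c _; rewrite /D.
  set b := copies_before kY s _; set b0 := copies_before kX s _.
  rewrite Na natrX; have [le|/ltnW le] := leqP b0 b.
    rewrite natrB //; move: (b%:R - b0%:R) (a%:R) => u v.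
    have := sqr_ge0 (v - u / 2); have := sqr_ge0 u; rewrite !expr2; lra.
  by rewrite (eqP le) mulr0 addr_ge0 ?sqr_ge0.
under eq_bigr do rewrite big_split /=.
rewrite big_split /= exchange_big /=.
apply: (@le_trans _ _ (\sum_(c < N) N%:R * #|{perm X}|%:R +
    \sum_(s : {perm X}) \sum_(c < N) N%:R)).
  by rewrite lerD2r; apply: ler_sum => c _; exact: sum_drift_sq.
have cN (u : R) : \sum_(c < N) u = N%:R * u by rewrite sumr_const card_ord mulr_natl.
have cP (u : R) : \sum_(s : {perm X}) u = u * #|{perm X}|%:R.
  by rewrite mulr_natr sumr_const.
rewrite !cN cP le_eqVlt; apply/orP; left; apply/eqP.
set u := N%:R; set v := #|{perm X}|%:R; clearbody u v; ring.
Qed.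

End Inversions.

(** * From contention resolution to secretary algorithms *)

Section Simulation.
Variables (R : realType) (E T : finType) (M : matroid E) (t0 : T) (w : T -> E -> R).
Variables (m N : nat).
Local Notation copy := (E * T * 'I_N)%type.
Local Notation time := ('I_m.+1 * 'I_N)%type.
Implicit Types (e : E) (v : E -> R) (tau : E -> time) (H : {set E}) (pi : {perm copy}).

(** An arrival reveals only its own weight, not the weight vector. Its copy is therefore labelled by
    some vector giving [e] this weight, which determines the weight of the copy. *)
Definition label e (x : R) : T := odflt t0 [pick t | w t e == x].

Lemma labelP t e : w (label e (w t e)) e = w t e.
Proof. by rewrite /label; case: pickP => [t' /eqP //|/(_ t)]; rewrite eqxx. Qed.

Definition copy_elt (x : copy) : E := x.1.1.

Definition copy_family e (l : T) (c : 'I_N) : copy := (e, l, c).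

Lemma copy_family_inj e l : injective (copy_family e l).
Proof. by move=> c c' []. Qed.

Definition active_copy pi v (r : E -> 'I_N) e : copy :=
  copy_family e (label e (v e))
    (nth_copy (copy_family_inj (e := e) (l := label e (v e))) pi (r e)).

Definition sampled_in tau H : {set E} := [set e in H | (tau e).1 != ord_max].

(** Online, [H] is the set of arrivals so far; for [H = setT] this is the set of improving
    elements. *)
Definition active tau v H : {set E} :=
  [set e in H | ((tau e).1 == ord_max) &&
     ~~ spans M (sampled_in tau H :&: [set e' | heavier v e' e]) e].

Definition active_copies pi tau v H : {set copy} :=
  active_copy pi v (fun e => (tau e).2) @: active tau v H.

Lemma eq_active_copy pi v v' r r' e : v e = v' e -> r e = r' e ->
  active_copy pi v r e = active_copy pi v' r' e.
Proof. by rewrite /active_copy => -> ->. Qed.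

Lemma eq_active tau tau' v v' H : {in H, tau =1 tau'} -> {in H, v =1 v'} ->
  active tau v H = active tau' v' H.
Proof.
move=> et ev; apply/setP => e; rewrite [LHS]in_set [RHS]in_set.
have [eH|//] := boolP (e \in H); rewrite /= et //; congr (_ && ~~ spans _ _ _).
apply/setP => x; rewrite !inE -!andbA; have [xH|//] := boolP (x \in H).
by rewrite /= et // /heavier !ev.
Qed.

Lemma eq_active_copies pi tau tau' v v' H : {in H, tau =1 tau'} ->
  {in H, v =1 v'} -> active_copies pi tau v H = active_copies pi tau' v' H.
Proof.
move=> et ev; rewrite /active_copies (eq_active et ev).
apply: eq_in_imset => e; rewrite inE => /andP[eH _].
by apply: eq_active_copy; rewrite ?ev ?et.
Qed.

(** The lexicographic order: sampled elements precede late ones, and late ones are sorted by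
    rank. *)
Definition time_key (x : time) : nat := (x.1 * N + x.2)%N.

Lemma time_key_lt (x x' : time) : x.1 != ord_max -> x'.1 = ord_max ->
  (time_key x < time_key x')%N.
Proof.
case: x x' => [q r] [q' r'] /= qm ->; rewrite /time_key /=.
have : (q < m)%N.
  rewrite ltn_neqAle -ltnS ltn_ord andbT.
  by apply: contra qm => /eqP h; apply/eqP/val_inj.
by have := ltn_ord r; nia.
Qed.

Lemma time_key_max (x x' : time) : x.1 = ord_max -> x'.1 = ord_max ->
  (time_key x <= time_key x')%N = (x.2 <= x'.2)%N.
Proof. by rewrite /time_key => -> ->; rewrite leq_add2l. Qed.

(* When the ranks of two elements tie, one of the two ordered pairs is bad. *)
Definition bad_pair pi tau v e e' : bool :=
  ((tau e).2 <= (tau e').2)%N &&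
  (pos pi (active_copy pi v (fun e => (tau e).2) e') <=
   pos pi (active_copy pi v (fun e => (tau e).2) e))%N.

Definition good pi tau v : bool :=
  [forall e, forall e', (e != e') ==> ~~ bad_pair pi tau v e e'].

Section Policy.
Variables (a : seq (copy * bool) -> bool) (pi : {perm copy}) (Z : E -> time).
Hypothesis aP : forall (Q : {set copy}) (s : {perm copy}),
  let S := acc a (hist (fun x => x \in Q) s) in
  (S \subset Q) && (S \in indep (parallel copy_elt M)).
Implicit Types h : seq (E * R).

Definition arrived h : {set E} := [set e in unzip1 h].
Definition time_in h e : time := Z (nth e (enum E) (index e (unzip1 h))).
Definition value_in h e : R := (nth (e, 0) h (index e (unzip1 h))).2.

(* [Z] gives the time of the [k]-th arrival, the positions being listed by
   [enum E]; it has to be nondecreasing for the sampled elements to come first. *)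
Definition simulation h : bool :=
  if rev h is p :: _ then
    (p.1 \in active (time_in h) (value_in h) (arrived h)) &&
    (active_copy pi (value_in h) (fun e => (time_in h e).2) p.1 \in
      acc a (hist (fun x => x \in
        active_copies pi (time_in h) (value_in h) (arrived h)) pi))
  else false.

Definition assigned (s : {perm E}) e : time := Z ((s^-1)%g e).

Lemma index_arrival (s : {perm E}) e :
  index e (arrival_order s) = index ((s^-1)%g e) (enum E).
Proof. by rewrite -{1}(permKV s e) index_map //; exact: perm_inj. Qed.

Lemma simulationE v (s : {perm E}) e :
  let o := arrival_order s in
  let H := [set e' in take (index e o).+1 o] in
  (e \in acc simulation (hist v s)) =
  (e \in active (assigned s) v H) &&
  (active_copy pi v (fun e => (assigned s e).2) e \in
     acc a (hist (fun x => x \in active_copies pi (assigned s) v H) pi)).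
Proof.
move=> o H; rewrite mem_acc_hist -/o; set h := [seq _ | _ <- _].
have ko : (index e o < size o)%N by rewrite index_mem mem_arrival.
have uh : unzip1 h = take (index e o).+1 o by rewrite /unzip1 -map_comp map_id.
have Hh : arrived h = H by rewrite /arrived uh.
have idx e' : e' \in H -> index e' (unzip1 h) = index e' o.
  rewrite inE uh => e'H.
  by have := index_cat e' (take (index e o).+1 o) (drop (index e o).+1 o);
    rewrite cat_take_drop e'H => ->.
have inH e' : (e' \in H) = (index e' o < (index e o).+1)%N.
  by rewrite inE in_take // mem_arrival.
have et : {in H, time_in h =1 assigned s}.
  move=> e' e'H; rewrite /time_in idx // index_arrival nth_index //.
  by rewrite mem_enum.
have ev : {in H, value_in h =1 v}.
  move=> e' e'H; rewrite /value_in idx //.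
  rewrite (nth_map e') /=; last by rewrite size_takel // -inH.
  by rewrite nth_take -?inH // nth_index // mem_arrival.
have eH : e \in H by rewrite inH.
rewrite /simulation.
have -> : rev h = (e, v e) :: behead (rev h).
  rewrite /h -map_rev (take_nth e) // rev_rcons /= nth_index //.
  exact: mem_arrival.
rewrite Hh (eq_active et ev) (eq_active_copies _ et ev) /=.
by rewrite (@eq_active_copy _ _ v _ (fun e => (assigned s e).2)) ?ev ?et.
Qed.

Lemma active_copies_elt tau v H x : x \in active_copies pi tau v H ->
  x = active_copy pi v (fun e => (tau e).2) (copy_elt x) /\
  copy_elt x \in active tau v H.
Proof. by case/imsetP => e eA ->. Qed.

(** The online run sees only the copies of arrived elements. Without bad pairs, no active copy of a
    later element precedes the copy of [e] in [pi], so the decision on [e] agrees with that of the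
    full run. *)
Lemma simulation_good v (s : {perm E}) :
  (forall e e', (index e (arrival_order s) < index e' (arrival_order s))%N ->
     (time_key (assigned s e) <= time_key (assigned s e'))%N) ->
  good pi (assigned s) v ->
  acc simulation (hist v s) = copy_elt @:
    acc a (hist (fun x => x \in active_copies pi (assigned s) v setT) pi).
Proof.
move=> srt /forallP gd.
set tau := assigned s in srt gd *; set B := acc a _.
have /andP[BA _] := aP (active_copies pi tau v setT) pi.
have BE e : (e \in copy_elt @: B) = (active_copy pi v (fun e => (tau e).2) e \in B).
  apply/imsetP/idP => [[x xB ->]|xB].
    by have [<- _] := active_copies_elt (subsetP BA _ xB).
  by exists (active_copy pi v (fun e => (tau e).2) e).
have BT e : active_copy pi v (fun e => (tau e).2) e \in B -> e \in active tau v setT.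
  by move/(subsetP BA)/active_copies_elt => [].
apply/setP => e; rewrite simulationE BE -/tau.
set o := arrival_order s; set H := [set e' in _].
have inH e' : (e' \in H) = (index e' o <= index e o)%N.
  by rewrite inE in_take ?mem_arrival // ltnS.
have eH : e \in H by rewrite inH.
have [em|nm] := eqVneq (tau e).1 ord_max; last first.
  have -> : e \in active tau v H = false by rewrite inE (negPf nm) andbF.
  apply/esym/negbTE/negP => /BT; rewrite inE (negPf nm) andbF //.
(* Sampled elements have smaller keys than the late element [e], so all of them have arrived. *)
have sampE : sampled_in tau H = sampled_in tau setT.
  apply/setP => e'; rewrite !inE -/(e' \in H) /=.
  have [//|qm /=] := eqVneq (tau e').1 ord_max; first by rewrite andbF.
  rewrite andbT; have := inH e'; rewrite inE => ->; rewrite leqNgt; apply/negP => /srt.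
  by rewrite leqNgt time_key_lt.
have actE e' : e' \in H -> (e' \in active tau v H) = (e' \in active tau v setT).
  by move=> e'H; rewrite /active [LHS]in_set [RHS]in_set sampE e'H in_setT.
rewrite actE //; have [eA|nA] /= := boolP (e \in active tau v setT); last first.
  by apply/esym/negbTE; apply: contra nA; exact: BT.
rewrite /B !mem_acc_hist; congr a; apply/eq_in_map => x xin; congr pair.
set x0 := active_copy _ _ _ e in xin *.
have xpos : (pos pi x <= pos pi x0)%N.
  have := xin; rewrite in_take ?mem_arrival // ltnS.
apply/idP/idP.
  case/imsetP => e' e'A ->; apply: imset_f.
  by rewrite -actE //; move: e'A; rewrite inE => /andP[].
case/active_copies_elt => xE xA; rewrite xE; apply: imset_f.
set e' := copy_elt x in xE xA *.
have e'H : e' \in H.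
  rewrite inH leqNgt; apply/negP => lt.
  have ne : e != e' by apply/eqP => ee'; rewrite ee' ltnn in lt.
  have em' : (tau e').1 = ord_max.
    by move: xA; rewrite inE => /andP[_ /andP[/eqP]].
  have := srt _ _ lt; rewrite time_key_max // => le.
  have /forallP/(_ e')/implyP/(_ ne) := gd e.
  by rewrite /bad_pair le /= -xE xpos.
by rewrite actE.
Qed.

End Policy.
End Simulation.

Lemma exists_ge_average (R : realType) (I : finType) (f : I -> R) C :
  (0 < #|I|)%N -> C * #|I|%:R <= \sum_i f i -> exists i, C <= f i.
Proof.
move=> /card_gt0P[i0 _] H; apply/existsP; apply: contraT.
rewrite negb_exists => /forallP lt.
suff : \sum_i f i < C * #|I|%:R by rewrite ltNge H.
have -> : C * #|I|%:R = \sum_(i : I) C by rewrite sumr_const mulr_natr.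
have ltC i : f i < C by rewrite ltNge lt.
by rewrite (bigD1 i0) // [ltRHS](bigD1 i0) //= ltr_leD // ler_sum // => i _; rewrite ltW.
Qed.

Lemma sort_perm (E : finType) (k : E -> nat) : exists g : {perm E},
  forall a b, (index a (enum E) < index b (enum E))%N -> (k (g a) <= k (g b))%N.
Proof.
pose le := relpre k leq; pose l := sort le (enum E).
have le_total : total le by move=> a b; exact: leq_total.
have le_trans : transitive le by move=> a b c; exact: leq_trans.
have lu : uniq l by rewrite sort_uniq enum_uniq.
have sl : size l = size (enum E) by rewrite size_sort.
have idx a : (index a (enum E) < size l)%N by rewrite sl index_mem mem_enum.
pose gf a := nth a l (index a (enum E)).
have gfE x a : gf a = nth x l (index a (enum E)) by exact: set_nth_default.
have gi : injective gf.
  move=> a b; rewrite (gfE a b) /gf => /eqP; rewrite nth_uniq // => /eqP.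
  by move=> /(congr1 (nth a (enum E))); rewrite !nth_index ?mem_enum.
exists (perm gi) => a b ab; rewrite !permE (gfE a b) /gf.
have := sorted_leq_nth le_trans (fun x => leqnn (k x)) a (sort_sorted le_total (enum E)).
by apply; rewrite ?inE ?idx // ltnW.
Qed.

Section Rearrange.
Variables (R : realType) (E T : finType) (g : {ffun E -> T} -> {perm E}).

(** Sorted times handed out along a uniform arrival order are again independent and uniform: for
    fixed [tau], composing with [g tau] is a bijection of the orders. *)
Lemma sum_rearranged (F : {ffun E -> T} -> R) :
  \sum_(tau : {ffun E -> T}) \sum_(s : {perm E}) F [ffun e => tau (g tau ((s^-1)%g e))] =
  #|{perm E}|%:R * \sum_tau F tau.
Proof.
transitivity (\sum_(tau : {ffun E -> T}) \sum_(s : {perm E}) F [ffun e => tau (s e)]).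
  apply: eq_bigr => tau _.
  rewrite [RHS](reindex_inj (h := fun s : {perm E} => (s^-1 * g tau)%g)) /=.
    apply: eq_bigr => s _; congr F; apply/ffunP => e.
    by rewrite !ffunE permM.
  by move=> s s' /mulIg /invg_inj.
rewrite exchange_big /=.
have -> : #|{perm E}|%:R * \sum_tau F tau = \sum_(s : {perm E}) \sum_tau F tau.
  by rewrite sumr_const mulr_natl.
apply: eq_bigr => s _.
pose f (tau : {ffun E -> T}) : {ffun E -> T} := [ffun e => tau ((s^-1)%g e)].
rewrite (reindex_inj (h := f)) /=.
  apply: eq_bigr => tau _; congr F; apply/ffunP => e.
  by rewrite !ffunE permK.
move=> tau tau' /ffunP H; apply/ffunP => e.
by have := H (s e); rewrite !ffunE permK.
Qed.

End Rearrange.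

Lemma sum_ffun_pair (R : realType) (E A B : finType)
    (F : {ffun E -> A} -> {ffun E -> B} -> R) :
  \sum_(tau : {ffun E -> A * B}) F [ffun e => (tau e).1] [ffun e => (tau e).2] =
  \sum_q \sum_r F q r.
Proof.
rewrite pair_big /=.
rewrite (reindex (fun z : {ffun E -> A} * {ffun E -> B} =>
   [ffun e => (z.1 e, z.2 e)] : {ffun E -> A * B})) /=.
  by apply: eq_bigr => -[q r] _ /=; congr F; apply/ffunP => e; rewrite !ffunE.
exists (fun tau : {ffun E -> A * B} => ([ffun e => (tau e).1], [ffun e => (tau e).2])).
  by case=> q r _ /=; congr pair; apply/ffunP => e; rewrite !ffunE.
by move=> tau _; apply/ffunP => e; rewrite !ffunE /=; case: (tau e).
Qed.

Section Copies.
Variables (R : realType) (E T : finType) (M : matroid E) (t0 : T) (w : T -> E -> R).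
Variables (m N : nat).
Local Notation copy := (E * T * 'I_N)%type.
Local Notation time := ('I_m.+1 * 'I_N)%type.
Local Notation label := (label t0 w).
Local Notation active_copies := (active_copies M t0 w).
Local Notation parallelM := (parallel (@copy_elt E T N) M).
Local Notation lates := {ffun E -> 'I_m.+1}.
Local Notation indices := {ffun E -> 'I_N}.

Definition copy_of (t : T) (j : indices) e : copy := (e, label e (w t e), j e).

Definition improving_copies (t : T) (q : lates) (j : indices) : {set copy} :=
  copy_of t j @: improving M (worder (w t)) q.

Definition copy_weight (x : copy) : R := w x.1.2 x.1.1.

Lemma copy_ofK t j : cancel (copy_of t j) (@copy_elt E T N).
Proof. by []. Qed.

Lemma weight_copy_of t j (A : {set E}) :
  weight copy_weight (copy_of t j @: A) = weight (w t) A.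
Proof.
rewrite /weight big_imset /=; last by move=> x y _ _; exact: can_inj (copy_ofK t j) _ _.
by apply: eq_bigr => e _; exact: labelP.
Qed.

(* For a fixed order [pi] of the copies, activating the copy of a given rank
   amounts to activating the copy of a uniform index. *)
Lemma sum_active_copies (pi : {perm copy}) t (F : {set copy} -> R) :
  \sum_(tau : {ffun E -> time}) F (active_copies pi tau (w t) setT) =
  \sum_q \sum_j F (improving_copies t q j).
Proof.
pose G (q : lates) (r : indices) := F ([set active_copy t0 w pi (w t) r e | e in
  improving M (worder (w t)) q]).
transitivity (\sum_(tau : {ffun E -> time})
  G [ffun e => (tau e).1] [ffun e => (tau e).2]).
  apply: eq_bigr => tau _; congr F; rewrite /active_copies.
  have -> : active M tau (w t) setT = improving M (worder (w t)) [ffun e => (tau e).1].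
    apply/setP => e; rewrite !in_set negbK ffunE /=; congr (_ && ~~ spans _ _ _).
    by apply/setP => x; rewrite !in_set ffunE worderE.
  by apply: eq_in_imset => e _; apply: eq_active_copy; rewrite ?ffunE.
rewrite sum_ffun_pair; apply: eq_bigr => q _.
pose nc e := nth_copy (@copy_family_inj E T N e (label e (w t e))) pi.
pose f (r : indices) : indices := [ffun e => nc e (r e)].
rewrite [RHS](reindex_inj (h := f)) /=.
  apply: eq_bigr => r _; congr F; apply: eq_imset => e.
  by rewrite /active_copy /copy_of ffunE.
move=> r r' /ffunP H; apply/ffunP => e.
by have := H e; rewrite !ffunE; exact: perm_inj.
Qed.

(** For fixed indices [j] each element has one copy, so ranks are those of [M], and [improving_rk]
    applies to the preimage of [Z]. *)
Lemma improving_copies_rk t (Z : {set copy}) :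
  m%:R * (\sum_q \sum_j #|improving_copies t q j :&: Z|%:R) <=
  m.+1%:R * (\sum_q \sum_j (rk parallelM (improving_copies t q j :&: Z))%:R) :> R.
Proof.
rewrite exchange_big [in leRHS]exchange_big /= !mulr_sumr; apply: ler_sum => j _.
have IZ q : improving_copies t q j :&: Z =
    copy_of t j @: (improving M (worder (w t)) q :&: copy_of t j @^-1: Z).
  apply/setP => x; apply/idP/idP.
    by case/setIP => /imsetP[e eI ->] eZ; rewrite imset_f // in_setI eI inE.
  case/imsetP => e /setIP[eI eZ] ->; rewrite in_setI imset_f //=.
  by rewrite inE in eZ.
have := @improving_rk R E M m _ (@worder_inj R E (w t)) (copy_of t j @^-1: Z).
rewrite !mulr_sumr => H; apply: le_trans (le_trans _ H) _.
  by apply: ler_sum => q _; rewrite IZ card_imset //; exact: can_inj (copy_ofK t j).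
by apply: ler_sum => q _; rewrite IZ rk_parallel //; exact: copy_ofK.
Qed.

Variable a : nat.
Hypothesis Na : N = (a ^ 2)%N.

(** Only the ranks of [e] and [e'] matter; [sum_coord2] makes them independent and uniform, and
    [inversions_bound] yields a probability of at most [2 / a]. *)
Lemma bad_pair_bound t e e' : e != e' -> (0 < a)%N ->
  a%:R * (\sum_(pi : {perm copy}) \sum_(tau : {ffun E -> time})
     (bad_pair t0 w pi tau (w t) e e')%:R) <=
  2 * #|{ffun E -> time}|%:R * #|{perm copy}|%:R :> R.
Proof.
move=> ee' a0.
pose kX := @copy_family E T N e (label e (w t e)).
pose kY := @copy_family E T N e' (label e' (w t e')).
have kXY c c' : kX c != kY c' by apply/eqP => -[/eqP]; rewrite (negPf ee').
pose kXi : injective kX := @copy_family_inj E T N e (label e (w t e)).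
pose kYi : injective kY := @copy_family_inj E T N e' (label e' (w t e')).
have H := @inversions_bound R _ N kX kY kXi kYi kXY a Na.
pose B (pi : {perm copy}) (r r' : 'I_N) : R := ((r <= r') &&
  (pos pi (kY (nth_copy kYi pi r')) <= pos pi (kX (nth_copy kXi pi r))))%N%:R.
have sumtau pi : (m.+1 * N)%:R ^+ 2 * (\sum_(tau : {ffun E -> time})
    (bad_pair t0 w pi tau (w t) e e')%:R) =
    #|{ffun E -> time}|%:R * (m.+1%:R ^+ 2 * \sum_r \sum_r' B pi r r').
  have := @sum_coord2 R E time e e' (fun x y => B pi x.2 y.2) ee'.
  rewrite card_prod !card_ord => ->; congr (_ * _).
  rewrite -(pair_big xpredT xpredT (fun (_ : 'I_m.+1) r => \sum_b B pi r b.2)) /=.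
  rewrite sumr_const card_ord expr2 -mulrA -[LHS]mulr_natl; congr (_ * _).
  rewrite mulr_sumr; apply: eq_bigr => r _.
  rewrite -(pair_big xpredT xpredT (fun (_ : 'I_m.+1) r' => B pi r r')) /=.
  by rewrite sumr_const card_ord mulr_natl.
have NR : 0 < N%:R :> R by rewrite ltr0n Na expn_gt0 a0.
have sumtau' pi : N%:R ^+ 2 * (\sum_(tau : {ffun E -> time})
    (bad_pair t0 w pi tau (w t) e e')%:R) =
    #|{ffun E -> time}|%:R * \sum_r \sum_r' B pi r r'.
  have m1 : m.+1%:R ^+ 2 != 0 :> R by rewrite expf_neq0 // pnatr_eq0.
  apply: (mulfI m1); rewrite mulrA -exprMn -natrM sumtau mulrCA //.
have N2 : 0 < N%:R ^+ 2 :> R by rewrite exprn_gt0.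
rewrite -(ler_pM2l N2) mulrCA mulr_sumr; under eq_bigr do rewrite sumtau'.
rewrite -mulr_sumr [leLHS]mulrCA.
have := ler_wpM2l (ler0n R #|{ffun E -> time}|) H.
move: (#|{ffun E -> time}|%:R) (#|{perm copy}|%:R) => u v.
move=> /le_trans; apply; rewrite le_eqVlt; apply/orP; left; apply/eqP.
move: (N%:R) => x; ring.
Qed.

End Copies.

Section Reduction.
Variables (R : realType) (E T : finType) (M : matroid E) (t0 : T) (w : T -> E -> R).
Hypothesis w0 : forall t e, 0 <= w t e.
Variables (m a N : nat).
Hypotheses (Na : N = (a ^ 2)%N) (a0 : (0 < a)%N).
Local Notation copy := (E * T * 'I_N)%type.
Local Notation time := ('I_m.+1 * 'I_N)%type.
Local Notation parallelM := (parallel (@copy_elt E T N) M).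
Local Notation lates := {ffun E -> 'I_m.+1}.
Local Notation indices := {ffun E -> 'I_N}.

Variable d : seq (copy * bool) -> bool.
Hypothesis dP : crm_valid parallelM d.

(** A union bound over the ordered pairs of elements. *)
Lemma sum_bad t :
  a%:R * (\sum_(pi : {perm copy}) \sum_(tau : {ffun E -> time})
     (~~ good t0 w pi tau (w t))%:R) <=
  2 * #|E|%:R ^+ 2 * #|{ffun E -> time}|%:R * #|{perm copy}|%:R :> R.
Proof.
have badE (pi : {perm copy}) (tau : {ffun E -> time}) :
    (~~ good t0 w pi tau (w t))%:R <=
    \sum_e \sum_(e' | e != e') (bad_pair t0 w pi tau (w t) e e')%:R :> R.
  have [gd|] := boolP (good t0 w pi tau (w t)).
    by apply: sumr_ge0 => e _; apply: sumr_ge0 => e' _; exact: ler0n.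
  rewrite negb_forall => /existsP[e]; rewrite negb_forall => /existsP[e'].
  rewrite negb_imply negbK => /andP[ee' bd].
  rewrite (bigD1 e) //= (bigD1 e') //= bd -addrA lerDl addr_ge0 //.
    by apply: sumr_ge0 => i _; exact: ler0n.
  by apply: sumr_ge0 => i _; apply: sumr_ge0 => j _; exact: ler0n.
set u := #|{ffun E -> time}|%:R; set v := #|{perm copy}|%:R.
apply: (@le_trans _ _ (\sum_(e : E) \sum_(e' | e != e') a%:R *
   (\sum_(pi : {perm copy}) \sum_(tau : {ffun E -> time})
     (bad_pair t0 w pi tau (w t) e e')%:R))).
  under [leRHS]eq_bigr do rewrite -mulr_sumr.
  rewrite -mulr_sumr ler_wpM2l ?ler0n //.
  under [leRHS]eq_bigr do rewrite exchange_big /=.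
  rewrite [leRHS]exchange_big /=; apply: ler_sum => pi _.
  under [leRHS]eq_bigr do rewrite exchange_big /=.
  by rewrite [leRHS]exchange_big /=; apply: ler_sum => tau _; exact: badE.
have uv0 : 0 <= 2 * u * v by rewrite !mulr_ge0 ?ler0n.
apply: (@le_trans _ _ (\sum_(e : E) \sum_(e' : E) 2 * u * v)).
  apply: ler_sum => e _; rewrite big_mkcond; apply: ler_sum => e' _.
  by case: ifP => // ee'; exact: bad_pair_bound.
have cE (x : R) : \sum_(e : E) x = x * #|E|%:R by rewrite mulr_natr sumr_const.
rewrite !cE le_eqVlt; apply/orP; left; apply/eqP.
by set n := #|E|%:R; clearbody u v n; ring.
Qed.

Definition gained (pi : {perm copy}) (A : {set copy}) : R :=
  weight (@copy_weight R E T w N) (acc d (hist (fun x => x \in A) pi)).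

Lemma gained_elt t pi (tau : E -> time) :
  let A := active_copies M t0 w pi tau (w t) setT in
  let B := acc d (hist (fun x => x \in A) pi) in
  @copy_elt E T N @: B \in indep M /\
  weight (@copy_weight R E T w N) B = weight (w t) (@copy_elt E T N @: B).
Proof.
move=> A B; have /andP[BA] := dP A pi.
rewrite -/B inE => /andP[/imset_injP Bi BM]; split=> //.
rewrite /weight big_imset //=; apply: eq_bigr => x xB.
have [-> _] := active_copies_elt (subsetP BA x xB).
exact: labelP.
Qed.

(** Up to normalisation, [large] provides a gain of [2 * c * Y], and by [small] the failed
    simulations lose at most [c * Y]. Averaging then fixes the times and the order of the copies. *)
Lemma exists_policy (y : T -> R) (c : R) : (forall t, 0 <= y t) ->
  2 * #|E|%:R ^+ 2 * (\sum_t y t * weight (w t) setT) <=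
    a%:R * (c * \sum_t y t * rank M (w t)) ->
  2 * c * (\sum_t y t * rank M (w t)) * #|{ffun E -> time}|%:R * #|{perm copy}|%:R <=
    \sum_t y t * \sum_(pi : {perm copy}) \sum_(q : lates) \sum_(j : indices)
       gained pi (improving_copies M t0 w t q j) ->
  exists d', (forall h, uniq (unzip1 h) -> acc d' h \in indep M) /\
    #|{perm E}|%:R * (c * \sum_t y t * rank M (w t)) <=
    \sum_t y t * \sum_(s : {perm E}) weight (w t) (acc d' (hist (w t) s)).
Proof.
move=> y0 small large.
have key_sort (tau0 : {ffun E -> time}) := sort_perm (fun e => time_key (tau0 e)).
have [g gP] := choice key_sort.
pose pol (z : {ffun E -> time} * {perm copy}) : seq (E * R) -> bool :=
  guard M (simulation M t0 w d z.2 (fun e => z.1 (g z.1 e))).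
pose W t := weight (w t) setT.
(* When the simulation fails, this is at most 0, hence below whatever the guarded rule collects. *)
pose F t pi (tau : {ffun E -> time}) : R :=
  gained pi (active_copies M t0 w pi tau (w t) setT) -
  (~~ good t0 w pi tau (w t))%:R * W t.
have W0 t : 0 <= W t by apply: sumr_ge0 => e _.
have step t (tau0 : {ffun E -> time}) pi (s : {perm E}) :
    F t pi [ffun e => tau0 (g tau0 ((s^-1)%g e))] <=
    weight (w t) (acc (pol (tau0, pi)) (hist (w t) s)).
  set tau : {ffun E -> time} := [ffun e => _].
  have tauE : (tau : E -> time) = assigned (fun e => tau0 (g tau0 e)) s.
    by apply/funext => e; rewrite ffunE.
  have ge0 : 0 <= weight (w t) (acc (pol (tau0, pi)) (hist (w t) s)).
    by apply: sumr_ge0 => e _.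
  have [BM Bw] := gained_elt t pi tau.
  have gW : gained pi (active_copies M t0 w pi tau (w t) setT) <= W t.
    rewrite /gained Bw /W !weightE; apply: ler_sum => e _.
    by rewrite ler_wpM2l // in_setT ler_nat; case: (e \in _).
  rewrite /F; have [gd|_] := boolP (good t0 w pi tau (w t)); last first.
    by rewrite mul1r; apply: le_trans ge0; rewrite subr_le0.
  rewrite mul0r subr0 /gained Bw le_eqVlt; apply/orP; left; apply/eqP.
  congr weight; rewrite tauE in gd BM *.
  have sim := simulation_good dP _ gd.
  have srt e e' : (index e (arrival_order s) < index e' (arrival_order s))%N ->
      (time_key (assigned (fun e => tau0 (g tau0 e)) s e) <=
       time_key (assigned (fun e => tau0 (g tau0 e)) s e'))%N.
    by rewrite !index_arrival; exact: gP.
  have {sim}sim := sim srt.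
  rewrite -sim; have uh : uniq (unzip1 (hist (w t) s)).
    by rewrite unzip1_hist arrival_uniq.
  have [_ ->] := guardP M (simulation M t0 w d pi (fun e => tau0 (g tau0 e))) uh => //.
  by rewrite sim.
set Y := \sum_t y t * rank M (w t) in small large *.
set P := #|{perm E}|%:R; set u := #|{ffun E -> time}|%:R in large *.
set v := #|{perm copy}|%:R in large *.
have P0 : 0 <= P by exact: ler0n.
have aR : 0 < a%:R :> R by rewrite ltr0n.
have FY : c * Y * u * v <= \sum_t y t * \sum_pi \sum_tau F t pi tau.
  have FE t : \sum_pi \sum_tau F t pi tau =
      \sum_(pi : {perm copy}) \sum_(q : lates) \sum_(j : indices)
         gained pi (improving_copies M t0 w t q j) -
      (\sum_pi \sum_(tau : {ffun E -> time}) (~~ good t0 w pi tau (w t))%:R) * W t.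
    rewrite mulr_suml -sumrB; apply: eq_bigr => pi _.
    by rewrite sumrB -(sum_active_copies M t0 w m pi t (gained pi)) mulr_suml.
  under eq_bigr do rewrite FE mulrBr.
  rewrite sumrB; apply: le_trans (lerB large _); last first.
    apply: (@ler_sum _ _ _ _ _ (fun t =>
      y t * ((2 * #|E|%:R ^+ 2 * u * v / a%:R) * W t))).
    move=> t _; rewrite ler_wpM2l // ler_wpM2r // ler_pdivlMr // mulrC.
    exact: sum_bad.
  under [X in _ - X]eq_bigr do rewrite mulrCA.
  rewrite -mulr_sumr.
  have small' : 2 * #|E|%:R ^+ 2 * u * v / a%:R * (\sum_t y t * W t) <= c * Y * u * v.
    have uv0 : 0 <= u * v by rewrite mulr_ge0 ?ler0n.
    have := ler_wpM2r uv0 small.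
    rewrite -/u -/v -/P => h; rewrite mulrAC ler_pdivrMr //.
    move: h; rewrite -/(W _); set S := \sum_t y t * W t; set n := #|E|%:R.
    by clearbody u v Y n S; lra.
  by clearbody u v Y; lra.
have card0 : (0 < #|{: {ffun E -> time} * {perm copy}}|)%N.
  have N0 : (0 < N)%N by rewrite Na expn_gt0 a0.
  by apply/card_gt0P; exists ([ffun=> (ord0, Ordinal N0)], perm_one _).
have [|z zP] := @exists_ge_average R _ (fun z : {ffun E -> time} * {perm copy} =>
  \sum_t y t * \sum_s weight (w t) (acc (pol z) (hist (w t) s))) (P * (c * Y)) card0.
  rewrite card_prod natrM -/u -/v.
  have -> : P * (c * Y) * (u * v) = P * (c * Y * u * v) by clearbody u v P Y; ring.
  apply: le_trans (ler_wpM2l P0 FY) _.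
  rewrite exchange_big mulr_sumr; apply: ler_sum => t _ /=.
  rewrite -mulr_sumr mulrCA ler_wpM2l //.
  rewrite -(pair_big xpredT xpredT (fun tau0 pi =>
    \sum_s weight (w t) (acc (pol (tau0, pi)) (hist (w t) s)))) /=.
  rewrite [leRHS]exchange_big mulr_sumr; apply: ler_sum => pi _ /=.
  rewrite /P -(sum_rearranged g); apply: ler_sum => tau0 _; apply: ler_sum => s _.
  exact: step.
exists (pol z); split=> // h uh.
by have [] := guardP M (simulation M t0 w d z.2 (fun e => z.1 (g z.1 e))) uh.
Qed.

End Reduction.

Lemma weight_avg (R : realType) (X : finType) (rho : {set X} -> R)
    (f : {set X} -> {set X} -> R) (v : X -> R) :
  \sum_x v x * (\sum_Q rho Q * \sum_(S : {set X} | x \in S) f Q S) =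
  \sum_Q rho Q * \sum_S f Q S * weight v S.
Proof.
under eq_bigr do rewrite mulr_sumr.
rewrite exchange_big; apply: eq_bigr => Q _ /=.
under eq_bigr do rewrite mulrCA.
rewrite -mulr_sumr; congr (_ * _).
have E x : v x * \sum_(S : {set X} | x \in S) f Q S =
    \sum_S v x * (f Q S * (x \in S)%:R).
  by rewrite (sum_indic (fun S : {set X} => x \in S)) mulr_sumr.
rewrite (eq_bigr _ (fun x _ => E x)) exchange_big.
apply: eq_bigr => S _ /=; rewrite weightE mulr_sumr.
by apply: eq_bigr => x _; rewrite mulrCA.
Qed.

Section FinitePrior.
Variables (R : realType) (E T : finType) (M : matroid E) (w : T -> E -> R).
Variables (y : T -> R) (m : nat) (alpha beta : R).
Hypotheses (w0 : forall t e, 0 <= w t e) (y0 : forall t, 0 <= y t).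
Hypotheses (beta0 : 0 < beta) (alpha_m : alpha * m.+1%:R <= m%:R).

(** Improving elements keep [1 / (m + 1)] of the rank, the scheme keeps [beta] of that, and half is
    reserved for failed simulations. *)
Let c := beta / (2 * m.+1%:R).
Let Y := \sum_t y t * rank M (w t).

(** The scheme receives the law of the improving copies, with the weight vector drawn proportionally
    to [y]. As the weight is a function of the copy, balance for each copy bounds the expected
    weight despite correlations. *)
Lemma finite_prior_policy :
  (forall N, exists phi : crs R (parallel (@copy_elt E T N) M),
     ro_crs phi /\ universal beta alpha phi) ->
  exists d, (forall h, uniq (unzip1 h) -> acc d h \in indep M) /\
    #|{perm E}|%:R * (c * Y) <=
    \sum_t y t * \sum_(s : {perm E}) weight (w t) (acc d (hist (w t) s)).
Proof.
move=> H.
have m0 : 0 < m.+1%:R :> R by rewrite ltr0n.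
have c0 : 0 < c by rewrite /c divr_gt0 // mulr_gt0.
have yr0 t : 0 <= y t * rank M (w t) by rewrite mulr_ge0 ?rank_ge0.
have [Y0|Yn0] := eqVneq Y 0.
  exists (fun=> false); split=> [h _|].
    by rewrite (_ : acc _ _ = set0) ?indep0 //; apply/setP => e; rewrite !inE andbF.
  rewrite Y0 !mulr0; apply: sumr_ge0 => t _; rewrite mulr_ge0 //.
  by apply: sumr_ge0 => s _; apply: sumr_ge0.
have Yp : 0 < Y by rewrite lt0r Yn0 sumr_ge0.
have [t0 yt0] : exists t0, 0 < y t0.
  apply/existsP; apply: contraNT Yn0; rewrite negb_exists => /forallP yn.
  apply/eqP; apply: big1 => t _; suff -> : y t = 0 by rewrite mul0r.
  by apply/eqP; rewrite eq_le y0 andbT leNgt yn.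
pose W := \sum_t y t * weight (w t) setT.
have W0 : 0 <= W by apply: sumr_ge0 => t _; rewrite mulr_ge0 // sumr_ge0.
(* Any [a] above this value satisfies the first inequality of [exists_policy]. *)
pose x := 2 * #|E|%:R ^+ 2 * W / (c * Y).
have x0 : 0 <= x.
  apply: divr_ge0; last by rewrite mulr_ge0 ?ltW.
  by rewrite !mulr_ge0 ?exprn_ge0 ?ler0n.
have [a xa] : exists a : nat, x < a%:R.
  by exists (Num.bound x); exact: archi_boundP.
have a0 : (0 < a)%N by rewrite -(ltr0n R) (le_lt_trans x0 xa).
pose N := (a ^ 2)%N.
have [phi [phiR phiU]] := H N.
pose lates := {ffun E -> 'I_m.+1}; pose indices := {ffun E -> 'I_N}.
pose IC t (q : lates) (j : indices) := improving_copies M t0 w t q j.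
pose y1 := \sum_t y t.
have y1p : 0 < y1.
  by rewrite /y1 (bigD1 t0) //= ltr_pwDl // sumr_ge0.
have N0 : (0 < N)%N by rewrite expn_gt0 a0.
pose L : R := #|lates|%:R; pose J : R := #|indices|%:R.
have L0 : 0 < L by rewrite ltr0n; apply/card_gt0P; exists [ffun=> ord0].
have J0 : 0 < J by rewrite ltr0n; apply/card_gt0P; exists [ffun=> Ordinal N0].
pose K := y1 * L * J.
have K0 : 0 < K by rewrite !mulr_gt0.
pose rho0 S : R := (\sum_t y t * \sum_q \sum_j (IC t q j == S)%:R) / K.
have rhog (g : {set E * T * 'I_N} -> R) : \sum_S rho0 S * g S =
    (\sum_t y t * \sum_q \sum_j g (IC t q j)) / K.
  under eq_bigr do rewrite mulrAC mulr_suml.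
  rewrite -mulr_suml exchange_big; congr (_ / _); apply: eq_bigr => t _ /=.
  under eq_bigr do rewrite -mulrA mulr_suml.
  rewrite -mulr_sumr exchange_big; congr (_ * _); apply: eq_bigr => q _ /=.
  under eq_bigr do rewrite mulr_suml.
  rewrite exchange_big; apply: eq_bigr => j _ /=.
  rewrite (bigD1 (IC t q j)) //= eqxx mul1r big1 ?addr0 // => S SQ.
  by rewrite eq_sym (negPf SQ) mul0r.
have rho0_ge0 S : 0 <= rho0 S.
  rewrite divr_ge0 ?(ltW K0) //; apply: sumr_ge0 => t _; rewrite mulr_ge0 //.
  by do 2 (apply: sumr_ge0 => ? _); exact: ler0n.
have rho0_1 : \sum_S rho0 S = 1.
  have := rhog (fun=> 1); rewrite -mulr_suml mulr1 => ->.
  have -> : \sum_t y t * (\sum_(q : lates) \sum_(j : indices) 1) = K.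
    rewrite -mulr_suml /K -mulrA; congr (_ * _).
    by rewrite (eq_bigr (fun=> J)) ?sumr_const ?mulr_natl // => q _; rewrite sumr_const.
  by rewrite divff // gt_eqF.
pose rho := Fdist rho0_ge0 rho0_1.
have rhoU : uncontentious (parallel (@copy_elt E T N) M) alpha rho.
  apply: uncontentious_rk => Z /=.
  rewrite (rhog (fun Q => #|Q :&: Z|%:R)) (rhog (fun Q => (rk _ (Q :&: Z))%:R)).
  rewrite mulrA ler_wpM2r ?invr_ge0 ?(ltW K0) // mulr_sumr; apply: ler_sum => t _.
  rewrite mulrCA ler_wpM2l // -(ler_pM2l m0).
  apply: le_trans (improving_copies_rk M t0 w m t Z).
  rewrite mulrA [_ * alpha]mulrC ler_wpM2r //.
  by do 2 (apply: sumr_ge0 => ? _); exact: ler0n.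
have bal := phiU rho rhoU.
have [A [AV AE]] := phiR rho.
pose cw := @copy_weight R E T w N.
have cw0 z : 0 <= cw z by exact: w0.
pose v : R := #|{perm E * T * 'I_N}|%:R.
have v0 : 0 < v by exact: nperm_gt0.
have balw : beta * (\sum_S rho0 S * weight cw S) <=
    \sum_S rho0 S * \sum_S' phi rho S S' * weight cw S'.
  rewrite -weight_avg.
  have -> : \sum_S rho0 S * weight cw S =
      \sum_z cw z * \sum_(S : {set E * T * 'I_N} | z \in S) rho0 S.
    under eq_bigr do rewrite weightE mulr_sumr.
    rewrite exchange_big; apply: eq_bigr => z _ /=.
    rewrite [\sum_(S : {set _} | z \in S) _]sum_indic mulr_sumr.
    by apply: eq_bigr => S _; rewrite mulrCA.
  rewrite mulr_sumr; apply: ler_sum => z _.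
  by rewrite mulrCA ler_wpM2l //; exact: bal.
have [u uP] : exists u : seed A, v * (beta * (\sum_S rho0 S * weight cw S)) <=
    \sum_(j : {set E * T * 'I_N} * {perm E * T * 'I_N})
      rho0 j.1 * weight cw (accepted (fun z => z \in j.1) j.2 u).
  apply: (@derandomize R _ _ _ A (fun (j : {set E * T * 'I_N} * {perm E * T * 'I_N}) z =>
    z \in j.1) (fun j => j.2) (fun j S => rho0 j.1 * weight cw S)).
  apply: le_trans (ler_wpM2l (ltW v0) balw) _.
  rewrite -(pair_big xpredT xpredT (fun (Q : {set E * T * 'I_N}) s =>
     \sum_S fine (seed_law A [set u | accepted (fun z => z \in Q) s u = S]%classic) *
       (rho0 Q * weight cw S))) /= mulr_sumr.
  apply: ler_sum => Q _; rewrite le_eqVlt; apply/orP; left; apply/eqP.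
  rewrite mulrCA exchange_big mulr_sumr mulr_sumr; apply: eq_bigr => S _ /=.
  rewrite AE /output_law -/v [v * _]mulrA [v * _]mulrC divfK ?gt_eqF //.
  by rewrite mulrCA mulr_suml.
pose d := accept u.
have dV : crm_valid (parallel (@copy_elt E T N) M) d.
  by move=> Q s /=; have := AV Q s u; rewrite accepted_acc.
have large : v * (beta * (\sum_t y t * \sum_q \sum_j weight cw (IC t q j))) <=
    \sum_t y t * \sum_(pi : {perm E * T * 'I_N}) \sum_q \sum_j gained w d pi (IC t q j).
  move: uP; rewrite -(pair_big xpredT xpredT (fun (Q : {set E * T * 'I_N}) s =>
    rho0 Q * weight cw (accepted (fun z => z \in Q) s u))) /=.
  under [X in _ <= X -> _]eq_bigr do rewrite -mulr_sumr.
  rewrite (rhog (weight cw)) rhog !mulrA ler_pM2r ?invr_gt0 // => /le_trans; apply.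
  apply: ler_sum => t _; rewrite ler_wpM2l // le_eqVlt; apply/orP; left; apply/eqP.
  rewrite [RHS]exchange_big; apply: eq_bigr => q _; rewrite [RHS]exchange_big.
  apply: eq_bigr => j _; apply: eq_bigr => pi _.
  by rewrite /gained accepted_acc.
apply: (@exists_policy R E T M t0 w w0 m a N erefl a0 d dV y c y0).
  move: xa; rewrite /x ltr_pdivrMr ?mulr_gt0 //; exact: ltW.
apply: le_trans large.
have -> : 2 * c * Y * #|{ffun E -> 'I_m.+1 * 'I_N}|%:R * v =
    v * (beta * (m.+1%:R^-1 * (L * J * Y))).
  rewrite (_ : #|{ffun E -> 'I_m.+1 * 'I_N}|%:R = L * J).
    by rewrite /c; field; rewrite gt_eqF.
  by rewrite /L /J !card_ffun card_prod expnMn natrM.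
rewrite -/v ler_wpM2l ?(ltW v0) // ler_wpM2l ?(ltW beta0) // ler_pdivrMl //.
rewrite /Y !mulr_sumr; apply: ler_sum => t _.
rewrite mulrCA [leRHS]mulrCA ler_wpM2l //.
have -> : \sum_q \sum_j weight cw (IC t q j) =
    J * \sum_(q : lates) weight (w t) (improving M (worder (w t)) q).
  rewrite mulr_sumr; apply: eq_bigr => q _.
  under eq_bigr do rewrite weight_copy_of.
  by rewrite sumr_const mulr_natl.
rewrite mulrCA [L * J]mulrC -mulrA ler_wpM2l ?(ltW J0) //.
exact: improving_weight.
Qed.

End FinitePrior.

Lemma universal_to_secretary (R : realType) (beta alpha : R) :
  0 < beta -> alpha < 1 ->
  (forall (E : finType) (M : matroid E),
     exists phi : crs R M, ro_crs phi /\ universal beta alpha phi) ->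
  exists2 c : R, 0 < c & forall (E : finType) (M : matroid E),
    exists A : secretary_algorithm R M, competitive c A.
Proof.
move=> beta0 alpha1 H.
(* The sampling rate [m / (m + 1)] must reach [alpha], which is possible because [alpha < 1]. *)
have [m alpha_m] : exists m : nat, alpha * m.+1%:R <= m%:R.
  have a1 : 0 < 1 - alpha by rewrite subr_gt0.
  pose m := Num.bound (1 - alpha)^-1; exists m.
  have : (1 - alpha)^-1 < m%:R by apply: archi_boundP; rewrite invr_ge0 ltW.
  rewrite -[X in X < _ -> _]div1r ltr_pdivrMr // -natr1 => h.
  by move: (m%:R) h => z h; nra.
exists (beta / (2 * m.+1%:R)); first by rewrite divr_gt0 // mulr_gt0 // ltr0n.
move=> E M; set c := _ / _.
have c0 : 0 <= c by rewrite divr_ge0 ?(ltW beta0) // mulr_ge0 // ler0n.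
(* Truncation at 0 lets the limit range over all functions [E -> R] while every vector in play is
   nonnegative. *)
pose nn (w : E -> R) := fun e => Num.max 0 (w e).
have nn0 w e : 0 <= nn w e by rewrite /nn le_max lexx.
have nnE w : (forall e, 0 <= w e) -> nn w = w.
  by move=> w0; apply/funext => e; rewrite /nn; apply/max_idPr.
have P0 := nperm_gt0 R E.
have [l|P [PB PZ Pw]] := @behaviour_limit R E {perm E} R (E -> R : eqType)
  (fun h S => uniq (unzip1 h) ==> (S \in indep M)) (fun w s => hist (nn w) s)
  (fun w _ S => weight (nn w) S)
  (fun w => #|{perm E}|%:R * (c * rank M (nn w))).
  pose wl (i : 'I_(size l)) := nn (nth (fun=> 0) l i).
  pose D := {d : seq (E * R) -> bool | forall h, uniq (unzip1 h) -> acc d h \in indep M}.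
  pose F := {ffun 'I_(size l) * {perm E} -> {set E}}.
  pose code (d : D) : F := [ffun z : 'I_(size l) * {perm E} =>
    acc (sval d) (hist (wl z.1) z.2)].
  pose gain (f : F) i : R := \sum_s weight (wl i) (f (i, s)) -
    #|{perm E}|%:R * (c * rank M (wl i)).
  have [y y0|p [p0 p1 pD pa]] := @minimax_code R D F _ code gain.
    have [d [dM dy]] := @finite_prior_policy R E _ M wl y m alpha beta
      (fun i e => nn0 _ _) y0 beta0 alpha_m (fun N => H _ _).
    exists (exist _ d dM); rewrite /gain.
    under eq_bigr do rewrite mulrBr.
    rewrite sumrB subr_ge0; apply: le_trans (le_trans _ dy) _.
      rewrite -/c !mulr_sumr le_eqVlt; apply/orP; left; apply/eqP.
      by apply: eq_bigr => i _; rewrite mulrCA; congr (_ * _); rewrite mulrCA.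
    rewrite le_eqVlt; apply/orP; left; apply/eqP; apply: eq_bigr => i _.
    by congr (_ * _); apply: eq_bigr => s _; rewrite ffunE.
  have d0V (h : seq (E * R)) : uniq (unzip1 h) -> acc (fun=> false) h \in indep M.
    move=> _; rewrite (_ : acc _ _ = set0) ?indep0 //.
    by apply/setP => e; rewrite !inE andbF.
  have /choice[rep repP] : forall f : F, exists d : D, p f != 0 -> code d = f.
    move=> f; have [pf|pf] := eqVneq (p f) 0; first by exists (exist _ _ d0V).
    by have [d cd] := pD f pf; exists d.
  have mixB := mixture_behaviour (fun f => sval (rep f)) p0 p1.
  exists (mixture p (fun f => sval (rep f))); split=> //.
  - move=> h S; rewrite -p1; apply: ler_sum => f _.
    by rewrite -[leRHS]mulr1 ler_wpM2l // lern1 leq_b1.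
  - move=> h S; apply: contraNeq => /mixture_neq0[f [_ <-]].
    by apply/implyP; exact: (svalP (rep f)).
  - move=> w0 w0l; have li : (index w0 l < size l)%N by rewrite index_mem.
    have wlE : wl (Ordinal li) = nn w0 by rewrite /wl /= nth_index.
    rewrite -subr_ge0; have := pa (Ordinal li); congr (_ <= _).
    under eq_bigr do rewrite mulrBr mulr_sumr.
    rewrite sumrB -mulr_suml p1 mul1r wlE; congr (_ - _).
    rewrite exchange_big; apply: eq_bigr => s _ /=.
    rewrite mixture_sum; apply: eq_bigr => f _.
    have [->|pf] := eqVneq (p f) 0; first by rewrite !mul0r.
    by have /ffunP/(_ (Ordinal li, s)) := repP f pf; rewrite ffunE /= wlE => ->.
have [A AP] := realize PB.
have AM (w : E -> R) s (u : seed A) :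
    (forall e, 0 <= w e) -> accepted w s u \in indep M.
  move=> w0; have [_ /(_ u)[->|nz]] := AP w s; first exact: indep0.
  apply: contraNT nz => nM; apply/eqP/PZ; rewrite negb_imply nM andbT.
  by rewrite unzip1_hist arrival_uniq.
exists (SecretaryAlgorithm AM) => w w0.
have := Pw w; rewrite nnE // => Pw'.
rewrite -(ler_pM2l P0); apply: le_trans Pw' _.
rewrite exchange_big mulr_sumr le_eqVlt; apply/orP; left; apply/eqP.
apply: eq_bigr => S _ /=; rewrite /output_law mulrA [_ * (_ / _)]mulrC divfK ?gt_eqF //.
by rewrite mulr_suml; apply: eq_bigr => s _; have [-> _] := AP w s.
Qed.

Theorem theorem3p1 (R : realType) :
  ((exists (c : R)
      (A : forall (E : finType) (M : matroid E), secretary_algorithm R M),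
      0 < c /\
      forall (E : finType) (M : matroid E), competitive c (A E M))
   <->
   (exists beta alpha : R,
      [/\ 0 < beta, beta <= alpha & alpha < 1] /\
      forall (E : finType) (M : matroid E),
        exists phi : crs R M, ro_crs phi /\ universal beta alpha phi))
  /\
  ((exists beta alpha : R,
      [/\ 0 < beta, beta <= alpha & alpha < 1] /\
      forall (E : finType) (M : matroid E),
        exists phi : crs R M, ro_crs phi /\ universal beta alpha phi)
   <->
   (exists c : R,
      (0 < c <= 1) /\
      forall (E : finType) (M : matroid E),
        exists phi : crs R M, ro_crs phi /\
          forall alpha : R, 0 <= alpha <= 1 ->
            universal (c * alpha) alpha phi)).
Proof.
set i := exists (c : R) (A : forall (E : finType) (M : matroid E), _), _.
set ii := exists beta alpha : R, _.
set iii := exists c : R, (0 < c <= 1) /\ _.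
have i_iii : i -> iii.
  case=> c [A [c0 cA]]; exists (Num.min c 1); split.
    by rewrite lt_min c0 ltr01 ge_min lexx orbT.
  move=> E M; apply: (universal_secretary (A := A E M)).
    by rewrite le_min (ltW c0) ler01.
  move=> w w0; apply: le_trans (cA E M w w0).
  by rewrite ler_wpM2r ?rank_ge0 // ge_min lexx.
have iii_ii : iii -> ii.
  case=> c [/andP[c0 c1] H]; exists (c * 2^-1), 2^-1; split.
    by split; rewrite ?mulr_gt0 ?invr_gt0 ?ltr0n //; lra.
  move=> E M; have [phi [phiR phiU]] := H E M; exists phi; split=> //.
  by apply: phiU; lra.
have ii_i : ii -> i.
  case=> beta [alpha [[beta0 _ alpha1] H]].
  have [c c0 cA] := universal_to_secretary beta0 alpha1 H.
  exists c; exists (fun E M => projT1 (cid (cA E M))); split=> // E M.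
  exact: (projT2 (cid (cA E M))).
by split; [split=> [/i_iii/iii_ii|/ii_i]|split=> [/ii_i/i_iii|/iii_ii]].
Qed.
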